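(* Let $G=(V,E)$ be a chordal connected graph with $\#V=d$, set of maximal cliques $\mathcal{C}$ and set of separating cliques $\mathcal{S}$. Let $\mathring\Gamma$ be a partially-specified conditionally negative definite variogram with respect to $G$. Then the corresponding matrix completion problem is solved by $$\Theta=\sum_{C\in\mathcal{C}}\big[\theta(\mathring\Gamma_{C,C})\big]^d-\sum_{S\in\mathcal{S}}\nu(S)\big[\theta(\mathring\Gamma_{S,S})\big]^d ,$$ where $\nu(S)$ is the number of times the separating clique $S$ appears in a perfect sequence. That is, the strictly conditionally negative definite matrix $\Gamma$ solving the completion problem for $G$ and $\mathring\Gamma$ has signed Laplacian $\theta(\Gamma)=\Theta$.
   Context: A real symmetric matrix $\Gamma$ with zero diagonal is strictly conditionally negative definite (CND) if $v^\top\Gamma v<0$ for all $v\ne\mathbf{0}$ with $v\perp\mathbf{1}$. For a strictly CND matrix $\Gamma$, the matrix $$\operatorname{CM}(\Gamma)=\begin{pmatrix}-\tfrac12\Gamma&\mathbf{1}\\ \mathbf{1}^\top&0\end{pmatrix}$$ is invertible and $\theta(\Gamma)$ denotes the signed Laplacian matrix given by the upper-left block (of the size of $\Gamma$) of $\operatorname{CM}(\Gamma)^{-1}$; in particular $\theta$ of the $1\times1$ zero matrix is $[0]$. A partially-specified CND variogram $\mathring\Gamma$ with respect to $G=(V,E)$ is a symmetric partial matrix with zero diagonal, with entries specified for $(i,j)\in E$ (all other off-diagonal entries unspecified), whose principal submatrices $\mathring\Gamma_{C,C}$ indexed by cliques $C$ of $G$ are strictly CND. The matrix completion problem for $G$ and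 $\mathring\Gamma$ asks for a strictly CND matrix $\Gamma$ with $\Theta=\theta(\Gamma)$ such that $\Gamma_{ij}=\mathring\Gamma_{ij}$ for all $(i,j)\in E$ and $\Theta_{ij}=0$ for all $i\ne j$ with $(i,j)\notin E$. For $A\subset V$ and a matrix $N$ with rows and columns indexed by $A$, $[N]^d$ is the $d\times d$ matrix (indexed by $V$) equal to $N_{ij}$ for $i,j\in A$ and zero elsewhere. The maximal cliques of a chordal graph admit a perfect sequence, i.e. an ordering $C_1,\dots,C_m$ such that for every $j=2,\dots,m$ there is $i<j$ with $C_j\cap\bigcup_{\ell<j}C_\ell=C_j\cap C_i$. The separating cliques are the sets $S_j=C_j\cap\bigcup_{\ell<j}C_\ell$, $j=2,\dots,m$ (nonempty since $G$ is connected); $\mathcal{S}$ is the set of distinct $S_j$ and $\nu(S)=\#\{j: S_j=S\}$. *)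

(* Defs.v *)
From HB Require Import structures.
From mathcomp Require Import all_boot all_order all_algebra.
From mathcomp Require Import reals.

Set Implicit Arguments.
Unset Strict Implicit.
Unset Printing Implicit Defensive.

Import Order.TTheory GRing.Theory Num.Theory.
Local Open Scope ring_scope.

Section Matrices.
Variable R : realFieldType.

Definition strictly_cnd (n : nat) (A : 'M[R]_n) : Prop :=
  [/\ A^T = A,
      forall i, A i i = 0 &
      forall v : 'cV[R]_n,
        v != 0 -> \sum_i v i 0 = 0 -> (v^T *m A *m v) 0 0 < 0].

Definition CM (n : nat) (A : 'M[R]_n) : 'M[R]_(n + 1) :=
  block_mx (- (2^-1) *: A) (const_mx 1) (const_mx 1) 0.

(* [invmx] is the genuine inverse only when [CM A] is a unit matrix, which is
   the case for strictly CND [A] of size at least 1. *)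
Definition theta (n : nat) (A : 'M[R]_n) : 'M[R]_n := ulsubmx (invmx (CM A)).

(* Matrices with rows and columns indexed by [A : {set 'I_d}] are represented
   as 'M_#|A|, where [k : 'I_#|A|] stands for [enum_val k : 'I_d]. *)
Definition embed (d : nat) (A : {set 'I_d}) (N : 'M[R]_#|A|) : 'M[R]_d :=
  \sum_k \sum_l N k l *: delta_mx (enum_val k) (enum_val l).

Lemma embed_in (d : nat) (A : {set 'I_d}) (N : 'M[R]_#|A|) (k l : 'I_#|A|) :
  embed N (enum_val k) (enum_val l) = N k l.
Proof.
rewrite /embed summxE (bigD1 k) //= summxE (bigD1 l) //= !mxE !eqxx mulr1.
rewrite [X in _ + X + _]big1 ?addr0 => [|l' ll']; last first.
  rewrite !mxE !(inj_eq enum_val_inj) [_ == l']eq_sym.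
  by rewrite (negbTE ll') andbF mulr0.
rewrite big1 ?addr0 // => k' kk'; rewrite summxE big1 // => l' _.
by rewrite !mxE !(inj_eq enum_val_inj) [_ == k']eq_sym (negbTE kk') mulr0.
Qed.

Lemma embed_out (d : nat) (A : {set 'I_d}) (N : 'M[R]_#|A|) (i j : 'I_d) :
  ~~ ((i \in A) && (j \in A)) -> embed N i j = 0.
Proof.
move=> nA; rewrite /embed summxE big1 // => k _; rewrite summxE big1 // => l _.
rewrite !mxE; case: eqP => [ei|_]; last by rewrite mulr0.
case: eqP => [ej|_]; last by rewrite mulr0.
by move: nA; rewrite ei ej !enum_valP.
Qed.

(* A partial matrix is a matrix over [option R], [None] being an unspecified
   entry.  The default value 0 is never used when all the entries indexed by
   [A] are specified, in particular when [A] is a clique. *)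
Definition principal_sub (d : nat) (P : 'M[option R]_d) (A : {set 'I_d}) :
    'M[R]_#|A| :=
  \matrix_(k, l) odflt 0 (P (enum_val k) (enum_val l)).

End Matrices.

Section Graphs.
Variables (d : nat) (e : rel 'I_d).

Definition connected_graph : Prop :=
  (0 < d)%N /\ forall x y, connect e x y.

(* Every cycle on at least four distinct vertices has a chord: an edge between
   two vertices of the cycle that are not consecutive on it. *)
Definition chordal : Prop :=
  forall s : seq 'I_d, ucycle e s -> (3 < size s)%N ->
    exists x y, [/\ x \in s, y \in s, e x y, y != next s x & x != next s y].

Definition clique : pred {set 'I_d} :=
  fun C => [forall x in C, forall y in C, (x != y) ==> e x y].

Definition max_cliques : {set {set 'I_d}} := [set C | maxset clique C].

(* Sequences are indexed from 0, so that the separators are those of the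
   indices 0 < j < size cs. *)
Definition separator (cs : seq {set 'I_d}) (j : nat) : {set 'I_d} :=
  nth set0 cs j :&: \bigcup_(l < j) nth set0 cs l.

Definition perfect_sequence (cs : seq {set 'I_d}) : Prop :=
  perm_eq cs (enum max_cliques) /\
  forall j, (0 < j < size cs)%N ->
    exists2 i, (i < j)%N &
      separator cs j = nth set0 cs j :&: nth set0 cs i.

Definition separators (cs : seq {set 'I_d}) : seq {set 'I_d} :=
  [seq separator cs j | j <- iota 1 (size cs).-1].

Definition separating_cliques (cs : seq {set 'I_d}) : {set {set 'I_d}} :=
  [set S in separators cs].

Definition nu (cs : seq {set 'I_d}) (S : {set 'I_d}) : nat :=
  count_mem S (separators cs).

End Graphs.

Section Completion.
Variables (R : realFieldType) (d : nat) (e : rel 'I_d) (P : 'M[option R]_d).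

Definition partial_variogram : Prop :=
  [/\ P^T = P,
      forall i, P i i = Some 0,
      forall i j, i != j -> isSome (P i j) = e i j &
      forall C, clique e C -> strictly_cnd (principal_sub P C)].

Definition solves_completion (Gamma : 'M[R]_d) : Prop :=
  [/\ strictly_cnd Gamma,
      forall i j, e i j -> P i j = Some (Gamma i j) &
      forall i j, i != j -> ~~ e i j -> theta Gamma i j = 0].

Definition clique_Theta (cs : seq {set 'I_d}) : 'M[R]_d :=
  \sum_(C in max_cliques e) embed (theta (principal_sub P C))
  - \sum_(S in separating_cliques cs)
      embed (theta (principal_sub P S)) *+ nu cs S.

End Completion.

(* Main.v *)
Require Import Defs.
From HB Require Import structures.
From mathcomp Require Import all_boot all_order all_algebra.
From mathcomp Require Import reals.
From mathcomp Require Import lra zify.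

Set Implicit Arguments.
Unset Strict Implicit.
Unset Printing Implicit Defensive.

Import Order.TTheory GRing.Theory Num.Theory.
Local Open Scope ring_scope.

(** Why the theorem holds.

    Everything is read off the bordered matrix [M = CM Gamma], whose index set
    is the vertex set together with one extra index, the apex; the apex acts as
    a vertex joined to all the others, and [cone A] is [A] with the apex added.
    A [local_inverse M X J] is the inverse of the block of [M] on [X], padded
    with zeros, so that [theta] of the submatrix of [Gamma] on [A] is the
    vertex block of the local inverse on [cone A] ([embed_theta]).

    The linear algebra concerns a set [A :|: B] whose two parts overlap in
    [S = A :&: B].  Let [JA], [JB], [JS] be the local inverses on the three
    cones.  The following are equivalent: the inverse on the union vanishes
    between the two sides of [S]; the Schur complement [M - M *m JS *m M]
    vanishes there ([decoupled]).  In that case the inverse on the union is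
    [JA + JB - JS] ([local_inverseU], [inverse_zero_decoupled]).  The
    decoupling condition prescribes the entries of [Gamma] between the two
    sides in terms of the others, hence data on [A] and on [B] agreeing on [S]
    have exactly one decoupled extension.  That extension is again strictly
    conditionally negative definite, because completing the square splits the
    quadratic form into the Schur complements of the two sides and the form on
    [S], each of which is controlled by [A] or by [B] ([bordered_posU]).
    All this needs [S] to be nonempty, since the block of [M] on the apex alone
    is the zero matrix.

    A connected chordal graph is built up from a clique by such gluings, [B]
    being a vertex together with its clique of neighbours in [A]: this is the
    elimination of a simplicial vertex ([simplicial_nonneighbour],
    [chordal_connected_ind]).  Induction gives existence and uniqueness of the
    completion ([solves_on_unique_exists]).

    A perfect sequence decomposes the graph in the same way, with [B] the last
    clique, [A] the union of the preceding ones and [S] the separator.  Removing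
    the cliques one at a time from the end, every step changes the inverse by
    the term of the clique minus the term of its separator ([theta_perfect]),
    and the terms add up to the claimed formula. *)

(** * Inverses of principal blocks *)

Section LocalInverse.
Variables (R : fieldType) (n : nat).
Implicit Types (X Y : {set 'I_n}) (M J : 'M[R]_n).

Definition proj X : 'M[R]_n := diag_mx (\row_i (i \in X)%:R).

Lemma proj_mulE m X (A : 'M[R]_(n, m)) i j :
  (proj X *m A) i j = if i \in X then A i j else 0.
Proof.
by rewrite mul_diag_mx !mxE; case: ifP => _; rewrite ?mul1r ?mul0r.
Qed.

Lemma mul_projE m X (A : 'M[R]_(m, n)) i j :
  (A *m proj X) i j = if j \in X then A i j else 0.
Proof.
by rewrite mul_mx_diag !mxE; case: ifP => _; rewrite ?mulr1 ?mulr0.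
Qed.

Lemma tr_proj X : (proj X)^T = proj X.
Proof. exact: tr_diag_mx. Qed.

Lemma projM X Y : proj X *m proj Y = proj (X :&: Y).
Proof.
apply/matrixP => i j; rewrite proj_mulE !mxE in_setI.
by case: (i \in X) => //=; rewrite mul0rn.
Qed.

Lemma proj_setT : proj setT = 1%:M.
Proof. by apply/matrixP => i j; rewrite !mxE inE. Qed.

Lemma proj_setID X Y : proj X = proj (X :&: Y) + proj (X :\: Y).
Proof.
apply/matrixP => i j; rewrite !mxE !inE.
by case: (i \in X); case: (i \in Y); rewrite /= ?mul0rn ?addr0 ?add0r.
Qed.

Lemma proj_setU_eq m X Y (A B : 'M[R]_(n, m)) :
  proj X *m A = proj X *m B -> proj Y *m A = proj Y *m B ->
  proj (X :|: Y) *m A = proj (X :|: Y) *m B.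
Proof.
move=> /matrixP hX /matrixP hY; apply/matrixP => i j.
have := hY i j; have := hX i j; rewrite !proj_mulE inE.
by case: (i \in X); case: (i \in Y).
Qed.

Lemma proj_mul_sub m X Y (A : 'M[R]_(n, m)) :
  X \subset Y -> proj X *m A = A -> proj Y *m A = A.
Proof. by move=> XY <-; rewrite mulmxA projM (setIidPr XY). Qed.

Lemma mul_proj_sub m X Y (A : 'M[R]_(m, n)) :
  X \subset Y -> A *m proj X = A -> A *m proj Y = A.
Proof. by move=> XY <-; rewrite -mulmxA projM (setIidPl XY). Qed.

(** Keeping the inverse of a block at full size, padded with zeros, lets
    inverses of different blocks be added and compared. *)
Definition local_inverse M X J :=
  [/\ proj X *m J = J, J *m proj X = J,
      proj X *m M *m J = proj X & J *m M *m proj X = proj X].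

Lemma local_inverse_unique M X J J' :
  local_inverse M X J -> local_inverse M X J' -> J = J'.
Proof.
move=> [_ JE _ EJ] [E'J _ E'M _].
have <- : J *m M *m J' = J.
  by rewrite -{1}JE -!mulmxA [proj X *m _]mulmxA E'M JE.
by rewrite -{1}E'J mulmxA EJ.
Qed.

(** For symmetric [M] a one-sided inverse suffices: [J^T *m M *m J] equals both
    [J] and [J^T]. *)
Lemma local_inverse_sym M X J : M^T = M ->
  proj X *m J = J -> J *m proj X = J -> proj X *m M *m J = proj X ->
  J^T = J /\ local_inverse M X J.
Proof.
move=> Ms EJ JE EMJ.
have JtE : J^T *m proj X = J^T by rewrite -{2}EJ trmx_mul tr_proj.
have JtME : J^T *m M *m proj X = proj X.
  by have := congr1 trmx EMJ; rewrite !trmx_mul tr_proj Ms mulmxA.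
have Js : J^T = J.
  rewrite -[LHS]JtE -EMJ !mulmxA JtE -{2}EJ.
  by rewrite mulmxA JtME EJ.
by split=> //; split=> //; rewrite -{1}Js.
Qed.

Lemma local_inverse_tr M X J : M^T = M -> local_inverse M X J -> J^T = J.
Proof. by move=> Ms [EJ JE EMJ _]; case: (local_inverse_sym Ms EJ JE EMJ). Qed.

Lemma local_inverse_subl M X Y J : Y \subset X -> local_inverse M X J ->
  proj Y *m M *m J = proj Y.
Proof.
move=> YX [_ _ EMJ _].
by rewrite -(setIidPl YX) -!projM -!mulmxA [proj X *m _]mulmxA EMJ.
Qed.

Lemma local_inverse_ext M M' X J :
  proj X *m M *m proj X = proj X *m M' *m proj X ->
  local_inverse M X J -> local_inverse M' X J.
Proof.
move=> eqM [EJ JE EMJ JME]; split=> //.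
  by rewrite -[in LHS]EJ mulmxA -eqM -[X in _ = X]EMJ -!mulmxA EJ.
by rewrite -[in LHS]JE -!mulmxA [proj X *m _]mulmxA -eqM !mulmxA JE.
Qed.

Lemma local_inverse_out M X J i j :
  local_inverse M X J -> ~~ ((i \in X) && (j \in X)) -> J i j = 0.
Proof.
move=> [EJ JE _ _]; rewrite negb_and => /orP[iX|jX].
  by rewrite -EJ proj_mulE (negbTE iX).
by rewrite -JE mul_projE (negbTE jX).
Qed.

(** A nonsingular block is inverted by completing it with the identity on the
    other indices, which gives an invertible matrix of full size. *)
Lemma local_inverse_exists M X : M^T = M ->
  (forall x : 'cV[R]_n, proj X *m x = x -> proj X *m (M *m x) = 0 -> x = 0) ->
  exists J, local_inverse M X J.
Proof.
move=> Ms kerM; set E := proj X.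
have EE : E *m E = E by rewrite projM setIid.
pose F := E *m M *m E + (1%:M - E).
have EF : E *m F = E *m M *m E.
  by rewrite mulmxDr mulmxBr mulmx1 !mulmxA EE subrr addr0.
have FE : F *m E = E *m M *m E.
  by rewrite mulmxDl mulmxBl mul1mx -!mulmxA EE subrr addr0.
have Fs : F^T = F.
  rewrite /F linearD linearB /= trmx1 !trmx_mul Ms tr_proj.
  by rewrite mulmxA.
have Fu : F \in unitmx.
  rewrite -row_free_unit; apply: inj_row_free => v vF.
  have Fx : F *m v^T = 0 by rewrite -Fs -trmx_mul vF trmx0.
  have EMx : E *m M *m E *m v^T = 0 by rewrite -EF -mulmxA Fx mulmx0.
  have Ex : E *m v^T = v^T.
    move/eqP: Fx; rewrite mulmxDl EMx add0r mulmxBl mul1mx subr_eq0.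
    by move/eqP.
  apply: trmx_inj; rewrite trmx0; apply: kerM => //.
  by rewrite mulmxA -[RHS]EMx -[in RHS]mulmxA Ex.
have FiE : invmx F *m E = E *m invmx F.
  apply: (can_inj (mulKmx Fu)); rewrite mulKVmx // mulmxA FE -EF.
  by rewrite mulmxK.
exists (E *m invmx F).
have EJ : E *m (E *m invmx F) = E *m invmx F by rewrite mulmxA EE.
apply: (local_inverse_sym Ms _ _ _).2 => //.
  by rewrite -mulmxA FiE mulmxA EE.
by rewrite mulmxA -EF mulmxK.
Qed.

(** The block between the two sides of the Schur complement of the overlap
    vanishes; for covariance matrices this is conditional independence of the
    sides given the overlap. *)
Definition decoupled M X Y JS :=
  proj (X :\: Y) *m (M - M *m JS *m M) *m proj (Y :\: X) = 0.

Lemma decoupledC M X Y JS : M^T = M -> JS^T = JS ->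
  decoupled M X Y JS -> decoupled M Y X JS.
Proof.
rewrite /decoupled => Ms Js h; apply: trmx_inj; rewrite trmx0 -{}[RHS]h.
by rewrite !trmx_mul !tr_proj linearB /= !trmx_mul Ms Js !mulmxA.
Qed.

(** Seen from [X], the side [Y :\: X] acts only through the overlap. *)
Lemma decoupled_proj M X Y JY JS :
  local_inverse M Y JY -> local_inverse M (X :&: Y) JS ->
  decoupled M X Y JS -> proj X *m M *m JY = proj X *m M *m JS.
Proof.
move=> hY hS dec; have SY : X :&: Y \subset Y by apply: subsetIr.
case: (hY) (hS) => [EY _ EMY _] [_ SE ESMS EJS].
rewrite (proj_setID X Y) !mulmxDl (local_inverse_subl SY hY) ESMS.
congr (_ + _); set A := proj (X :\: Y) *m M.
have dP : A *m proj (Y :\: X) = A *m JS *m M *m proj (Y :\: X).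
  by apply/eqP; rewrite -subr_eq0 -[X in _ == X]dec mulmxBr mulmxBl !mulmxA.
have PE : proj (Y :\: X) = proj Y - proj (X :&: Y).
  by rewrite (proj_setID Y X) [Y :&: X]setIC addrAC subrr add0r.
have CJ : A *m JS *m M *m JY = A *m JS.
  rewrite -(mul_proj_sub SY SE) -!mulmxA.
  by rewrite [proj Y *m _]mulmxA EMY.
have CS : A *m JS *m M *m proj (X :&: Y) = A *m proj (X :&: Y).
  by rewrite -!mulmxA [JS *m _]mulmxA EJS.
rewrite -[in LHS]EY (proj_setID Y X) [Y :&: X]setIC mulmxA mulmxDr dP {}PE.
by rewrite mulmxBr CS addrC subrK -[LHS]mulmxA EY.
Qed.

(** The rows in [X] of [M *m (JX + JY - JS)] are right because there [M *m JY]
    and [M *m JS] cancel, and the rows in [Y] for the symmetric reason. *)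
Lemma local_inverseU M X Y JX JY JS : M^T = M ->
  local_inverse M X JX -> local_inverse M Y JY ->
  local_inverse M (X :&: Y) JS -> decoupled M X Y JS ->
  local_inverse M (X :|: Y) (JX + JY - JS).
Proof.
move=> Ms hX hY hS dec.
have hS' : local_inverse M (Y :&: X) JS by rewrite setIC.
have dec' := decoupledC Ms (local_inverse_tr Ms hS) dec.
have XY := decoupled_proj hY hS dec; have YX := decoupled_proj hX hS' dec'.
have sX := subsetUl X Y; have sY := subsetUr X Y.
have sS : X :&: Y \subset X :|: Y by apply: subset_trans (subsetIl _ _) sX.
case: (hX) (hY) (hS) => [lX rX EX _] [lY rY EY _] [lS rS _ _].
apply: (local_inverse_sym Ms _ _ _).2.
- by rewrite mulmxBr mulmxDr (proj_mul_sub sX lX) (proj_mul_sub sY lY)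
             (proj_mul_sub sS lS).
- by rewrite mulmxBl mulmxDl (mul_proj_sub sX rX) (mul_proj_sub sY rY)
             (mul_proj_sub sS rS).
rewrite -[RHS]mulmx1 -mulmxA; apply: proj_setU_eq;
  rewrite mulmx1 mulmxA mulmxBr mulmxDr.
  by rewrite EX XY addrK.
by rewrite EY YX addrAC subrr add0r.
Qed.

Lemma proj_setU3 X Y :
  proj (X :|: Y) = proj (X :&: Y) + (proj (X :\: Y) + proj (Y :\: X)).
Proof.
apply/matrixP => i j; rewrite !mxE !inE.
by case: (i \in X); case: (i \in Y); rewrite /= ?mul0rn ?addr0 ?add0r.
Qed.

Lemma proj_set0 : proj set0 = 0.
Proof. by apply/matrixP => i j; rewrite !mxE inE mul0rn. Qed.

(** The block of the inverse outside the overlap is the inverse of the Schur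
    complement; if the former is block diagonal, so is the latter. *)
Lemma inverse_zero_decoupled M X Y K JS : M^T = M ->
  local_inverse M (X :|: Y) K -> local_inverse M (X :&: Y) JS ->
  proj (X :\: Y) *m K *m proj (Y :\: X) = 0 -> decoupled M X Y JS.
Proof.
move=> Ms hK hS K0; rewrite /decoupled.
set A := proj (X :\: Y); set B := proj (Y :\: X); set N := M - _.
have [Ks Js] := (local_inverse_tr Ms hK, local_inverse_tr Ms hS).
have Ns : N^T = N by rewrite linearB /= !trmx_mul Ms Js mulmxA.
have sB : Y :\: X \subset X :|: Y.
  by apply: subset_trans (subsetUr X Y); apply: subsetDl.
have sA : X :\: Y \subset X :|: Y.
  by apply: subset_trans (subsetUl X Y); apply: subsetDl.
have sS : X :&: Y \subset X :|: Y.
  by apply: subset_trans (subsetUl X Y); apply: subsetIl.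
have [_ SE _ EJS] := hS; have [EK _ _ _] := hK.
have AB : A *m B = 0.
  rewrite projM -proj_set0; congr proj; apply/setP => i.
  by rewrite !inE; case: (i \in X); rewrite ?andbF.
have SB : proj (X :&: Y) *m B = 0.
  rewrite projM -proj_set0; congr proj; apply/setP => i.
  by rewrite !inE; case: (i \in X); rewrite ?andbF.
have NKB : N *m K *m B = M *m K *m B.
  rewrite !mulmxBl -[RHS]subr0; congr (_ - _).
  rewrite -SE -[M *m (JS *m _) *m _ *m _]mulmxA -!mulmxA.
  rewrite [proj (X :&: Y) *m _]mulmxA [_ *m (K *m _)]mulmxA.
  by rewrite (local_inverse_subl sS hK) SB !mulmx0.
have NS : N *m proj (X :&: Y) = 0.
  by rewrite mulmxBl -!mulmxA [JS *m _]mulmxA EJS subrr.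
have NKB' : N *m K *m B = N *m B *m (K *m B).
  move: (N) NS => N' NS.
  rewrite -[in LHS]EK proj_setU3 !mulmxDl !mulmxDr !mulmxDl !mulmxA.
  rewrite NS !mul0mx add0r.
  by rewrite -/A -/B -!mulmxA [A *m _]mulmxA K0 !mulmx0 add0r.
have ANBKB : A *m N *m B *m K *m B = 0.
  rewrite -!mulmxA [N *m _]mulmxA -NKB' NKB !mulmxA.
  by rewrite (local_inverse_subl sA hK).
have BNBKB : B *m N *m B *m K *m B = B.
  rewrite -!mulmxA [N *m _]mulmxA -NKB' NKB !mulmxA.
  by rewrite (local_inverse_subl sB hK) projM setIid.
(* The block of [N] on the side of [Y] is inverted by that of [K]. *)
have BKBNB : B *m K *m B *m N *m B = B.
  rewrite -[RHS]tr_proj -/B -[in RHS]BNBKB !trmx_mul !tr_proj -/B Ns Ks.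
  by rewrite !mulmxA.
by rewrite -[in LHS]BKBNB !mulmxA ANBKB !mul0mx.
Qed.

End LocalInverse.

(** * Positivity of bordered forms *)

Section BorderedPositivity.
Variables (R : realFieldType) (n : nat) (s : 'I_n).
Implicit Types (X Y T : {set 'I_n}) (M J : 'M[R]_n) (x : 'cV[R]_n).

(** Conditional definiteness in bordered form: [s] is the border index, and the
    row [s] of [M] expresses the linear constraint. *)
Definition bordered_pos M X := forall x,
  proj R X *m x = x -> (M *m x) s 0 = 0 ->
  0 <= (x^T *m M *m x) 0 0 /\
  ((x^T *m M *m x) 0 0 = 0 -> forall i, i != s -> x i 0 = 0).

Lemma bordered_pos_ext M M' X : s \in X ->
  proj R X *m M *m proj R X = proj R X *m M' *m proj R X ->
  bordered_pos M X -> bordered_pos M' X.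
Proof.
move=> sX eqM hM x Xx.
have eqMx : proj R X *m (M *m x) = proj R X *m (M' *m x).
  by rewrite -Xx !mulmxA eqM.
have eqs : (M *m x) s 0 = (M' *m x) s 0.
  by have /matrixP /(_ s 0) := eqMx; rewrite !proj_mulE sX.
have eqq : x^T *m M *m x = x^T *m M' *m x.
  by rewrite -[in LHS]Xx -[in RHS]Xx !trmx_mul !tr_proj -!mulmxA Xx eqMx.
by rewrite -eqs -eqq; apply: hM.
Qed.

(** A vector killed by the block satisfies the constraint and has value zero,
    so it is concentrated on [s]; the row [i] then kills its last entry. *)
Lemma bordered_pos_inverse M X i : M^T = M -> s \in X -> i \in X ->
  M i s != 0 -> bordered_pos M X -> exists J, local_inverse M X J.
Proof.
move=> Ms sX iX Mis hM; apply: local_inverse_exists => // x Xx XMx.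
have Mx j : j \in X -> (M *m x) j 0 = 0.
  by move=> jX; have /matrixP /(_ j 0) := XMx; rewrite proj_mulE jX [RHS]mxE.
have q0 : (x^T *m M *m x) 0 0 = 0.
  by rewrite -{1}Xx trmx_mul tr_proj -!mulmxA XMx mulmx0 mxE.
have [_ /(_ q0) x0] := hM x Xx (Mx s sX).
apply/matrixP => j k; rewrite (ord1 k) mxE.
have [->|/x0 //] := eqVneq j s; apply: (mulfI Mis); rewrite mulr0 -(Mx i iX) mxE.
by rewrite (bigD1 s) //= big1 ?addr0 // => l ls; rewrite x0 ?mulr0.
Qed.

(** The value of the Schur complement at [y] is the value of [M] at
    [y - JS *m M *m y], for [y] the part of [x] in [T]; this vector, the
    minimiser under the constraint over the entries in [Y], satisfies the
    constraint because [s] lies in [Y]. *)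
Lemma schur_form_pos M X Y T JS : M^T = M -> s \in Y -> Y \subset X ->
  T \subset X -> [disjoint T & Y] -> local_inverse M Y JS ->
  bordered_pos M X -> forall x,
  let q := x^T *m (proj R T *m (M - M *m JS *m M) *m proj R T) *m x in
  0 <= q 0 0 /\ (q 0 0 = 0 -> proj R T *m x = 0).
Proof.
move=> Ms sY YX TX dTY hJ hM x q.
have [YJ JY YMJ JMY] := hJ; have Js := local_inverse_tr Ms hJ.
have JMJ : JS *m M *m JS = JS.
  by rewrite -{1}JY -!mulmxA [proj R Y *m _]mulmxA YMJ JY.
pose a := proj R T *m x - JS *m M *m proj R T *m x.
have Ea : proj R X *m a = a.
  rewrite mulmxBr !mulmxA projM (setIidPr TX).
  by rewrite (proj_mul_sub YX YJ).
have Ma : (M *m a) s 0 = 0.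
  have : proj R Y *m (M *m a) = 0.
    by rewrite !mulmxBr !mulmxA YMJ subrr.
  by move/matrixP/(_ s 0); rewrite proj_mulE sY [RHS]mxE.
have -> : q = a^T *m M *m a.
  pose y := proj R T *m x.
  have -> : q = y^T *m (M - M *m JS *m M) *m y.
    by rewrite trmx_mul tr_proj /q !mulmxA.
  have -> : a = y - JS *m M *m y by rewrite /a /y !mulmxA.
  have -> : (y - JS *m M *m y)^T = y^T - y^T *m M *m JS.
    by rewrite linearB /= !trmx_mul Ms Js !mulmxA.
  rewrite !mulmxBr !mulmxBl !mulmxA.
  suff -> : y^T *m M *m JS *m M *m JS = y^T *m M *m JS by rewrite subrr subr0.
  by rewrite -[in RHS]JMJ !mulmxA.
have [q0 q1] := hM a Ea Ma; split=> // /q1 a0.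
apply/matrixP => i k; rewrite (ord1 k) proj_mulE mxE; case: ifP => // iT.
have iY : i \notin Y by rewrite (disjointFr dTY iT).
have /a0 : i != s by apply: contraNneq iY => ->.
by rewrite mxE proj_mulE iT mxE -YJ -!mulmxA proj_mulE (negbTE iY) subr0.
Qed.

(** Completing the square: the form is the sum of the Schur complement on the
    two sides, which do not interact when [M] is decoupled, and of the form on
    the overlap at [JS *m M *m x], which satisfies the constraint as [x] does. *)
Lemma bordered_posU M X Y JS : M^T = M -> s \in X :&: Y ->
  local_inverse M (X :&: Y) JS -> decoupled M X Y JS ->
  bordered_pos M X -> bordered_pos M Y -> bordered_pos M (X :|: Y).
Proof.
move=> Ms sS hJ dec hX hY x Zx Mx.
have [SJ JS' SMJ JMS] := hJ; have Js := local_inverse_tr Ms hJ.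
have dec' := decoupledC Ms Js dec.
set N := M - M *m JS *m M.
have dX : [disjoint X :\: Y & X :&: Y].
  rewrite -setI_eq0; apply/eqP/setP => i; rewrite !inE.
  by case: (i \in X); case: (i \in Y).
have dY : [disjoint Y :\: X & X :&: Y].
  rewrite -setI_eq0; apply/eqP/setP => i; rewrite !inE.
  by case: (i \in X); case: (i \in Y).
have [a0 a1] := schur_form_pos Ms sS (subsetIl X Y) (subsetDl X Y) dX hJ hX x.
have [b0 b1] := schur_form_pos Ms sS (subsetIr X Y) (subsetDl Y X) dY hJ hY x.
(* The part of the square that lives on the overlap. *)
pose u := JS *m M *m x.
have Eu : proj R X *m u = u.
  by rewrite !mulmxA (proj_mul_sub (subsetIl X Y) SJ).
have JMJ : JS *m M *m JS = JS.
  by rewrite -{1}JS' -!mulmxA [proj R _ *m _]mulmxA SMJ JS'.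
have Mu : (M *m u) s 0 = 0.
  have : proj R (X :&: Y) *m (M *m u) = proj R (X :&: Y) *m (M *m x).
    by rewrite !mulmxA SMJ.
  by move/matrixP/(_ s 0); rewrite !proj_mulE sS Mx.
have [c0 c1] := hX u Eu Mu.
have NS : N *m proj R (X :&: Y) = 0.
  by rewrite mulmxBl -!mulmxA [JS *m _]mulmxA JMS subrr.
have SN : proj R (X :&: Y) *m N = 0.
  by rewrite mulmxBr !mulmxA SMJ subrr.
have qE : x^T *m M *m x =
    x^T *m (proj R (X :\: Y) *m N *m proj R (X :\: Y)) *m x +
    x^T *m (proj R (Y :\: X) *m N *m proj R (Y :\: X)) *m x + u^T *m M *m u.
  have -> : u^T *m M *m u = x^T *m (M *m JS *m M) *m x.
    by rewrite /u !trmx_mul Ms Js -[in RHS]JMJ !mulmxA.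
  have -> : x^T *m M *m x = x^T *m N *m x + x^T *m (M *m JS *m M) *m x.
    by rewrite -mulmxDl -mulmxDr subrK.
  congr (_ + _); rewrite -[in LHS]Zx trmx_mul tr_proj proj_setU3.
  rewrite -mulmxDl -mulmxDr !mulmxA; congr (_ *m _).
  rewrite -!mulmxA; congr (_ *m _); rewrite !mulmxA.
  rewrite /decoupled -/N in dec dec'.
  move: N dec dec' NS SN => N dec dec' NS SN.
  rewrite [LHS]mulmxDr -[_ *m N *m _]mulmxA NS mulmx0 add0r mulmxDr.
  by rewrite !mulmxDl SN !mul0mx !add0r dec dec' add0r addr0.
have addE (A B : 'M[R]_1) : (A + B) 0 0 = A 0 0 + B 0 0 by rewrite mxE.
rewrite qE !addE; split; first by rewrite !addr_ge0.
move=> q0.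
have ab : proj R (X :\: Y) *m x = 0 /\ proj R (Y :\: X) *m x = 0.
  split; [apply: a1 | apply: b1]; apply: le_anti; rewrite ?a0 ?b0 ?andbT;
  rewrite -/N; move: q0 a0 b0 c0; rewrite -/N; lra.
have /c1 u0 : (u^T *m M *m u) 0 0 = 0.
  apply: le_anti; rewrite c0 andbT.
  by move: q0 a0 b0 c0; rewrite -/N; lra.
have ux : u = x.
  have Sx : x = proj R (X :&: Y) *m x.
    by rewrite -[LHS]Zx proj_setU3 !mulmxDl ab.1 ab.2 !addr0.
  by rewrite /u Sx mulmxA JMS.
by rewrite -ux.
Qed.

End BorderedPositivity.

(** * Bordered matrices of variograms *)

Section Cone.
Variable d : nat.
Implicit Types A B : {set 'I_d}.

Definition apex : 'I_(d + 1) := rshift d ord0.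

Definition cone A : {set 'I_(d + 1)} :=
  [set i | match split i with inl j => j \in A | inr _ => true end].

Lemma cone_lshift A i : (lshift 1 i \in cone A) = (i \in A).
Proof. by rewrite inE (unsplitK (inl i)). Qed.

Lemma cone_apex A : apex \in cone A.
Proof. by rewrite inE (unsplitK (inr ord0)). Qed.

Lemma cone_ind (K : 'I_(d + 1) -> Prop) :
  (forall i, K (lshift 1 i)) -> K apex -> forall i, K i.
Proof. by move=> Kl Kr i; case: (split_ordP i) => j -> //; rewrite (ord1 j). Qed.

Lemma coneI A B : cone (A :&: B) = cone A :&: cone B.
Proof. by apply/setP => i; rewrite !inE; case: split => // j; rewrite inE. Qed.

Lemma coneU A B : cone (A :|: B) = cone A :|: cone B.
Proof. by apply/setP => i; rewrite !inE; case: split => // j; rewrite inE. Qed.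

Lemma coneT : cone setT = setT.
Proof. by apply/setP => i; rewrite !inE; case: split => // j; rewrite inE. Qed.

Lemma cone_sub A B : A \subset B -> cone A \subset cone B.
Proof. by move/setIidPl => AB; apply/setIidPl; rewrite -coneI AB. Qed.

End Cone.

Section BorderedMatrices.
Variables (R : realFieldType) (d : nat).
Implicit Types (A B : {set 'I_d}) (Gamma : 'M[R]_d).

Lemma CM_ul Gamma i j : CM Gamma (lshift 1 i) (lshift 1 j) = - 2^-1 * Gamma i j.
Proof. by rewrite block_mxEul mxE. Qed.

Lemma CM_ur Gamma i : CM Gamma (lshift 1 i) (apex d) = 1.
Proof. by rewrite block_mxEur mxE. Qed.

Lemma CM_dl Gamma i : CM Gamma (apex d) (lshift 1 i) = 1.
Proof. by rewrite block_mxEdl mxE. Qed.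

Lemma CM_dr Gamma : CM Gamma (apex d) (apex d) = 0.
Proof. by rewrite block_mxEdr mxE. Qed.

Lemma CM_sym Gamma : Gamma^T = Gamma -> (CM Gamma)^T = CM Gamma.
Proof. by move=> Gs; rewrite /CM tr_block_mx linearZ /= Gs !trmx_const. Qed.

(** Strict conditional negative definiteness of the submatrix on [A], stated
    for full-size vectors supported in [A] so that different sets compare. *)
Definition cnd_on Gamma A := forall v : 'cV[R]_d,
  proj R A *m v = v -> v != 0 -> \sum_i v i 0 = 0 ->
  (v^T *m Gamma *m v) 0 0 < 0.

Lemma mul_ones n (v : 'cV[R]_n) : const_mx 1 *m v = (\sum_i v i 0)%:M :> 'M_1.
Proof.
apply/matrixP => i j; rewrite !ord1 !mxE mulr1n.
by apply: eq_bigr => k _; rewrite mxE mul1r.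
Qed.

Lemma mul_tr_ones n (v : 'cV[R]_n) : v^T *m const_mx 1 = (\sum_i v i 0)%:M :> 'M_1.
Proof.
apply/matrixP => i j; rewrite !ord1 !mxE mulr1n.
by apply: eq_bigr => k _; rewrite !mxE mulr1.
Qed.

Lemma proj_cone A (v : 'cV[R]_d) (t : 'cV[R]_1) :
  proj R (cone A) *m col_mx v t = col_mx (proj R A *m v) t.
Proof.
apply/matrixP => i j; rewrite proj_mulE; elim/cone_ind: i => [i|].
  by rewrite cone_lshift !col_mxEu proj_mulE.
by rewrite cone_apex !col_mxEd.
Qed.

Lemma CM_apex Gamma (v : 'cV[R]_d) (t : 'cV[R]_1) :
  (CM Gamma *m col_mx v t) (apex d) 0 = \sum_i v i 0.
Proof.
by rewrite mul_block_col col_mxEd mul0mx addr0 mul_ones mxE mulr1n.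
Qed.

(** On the constraint the apex coordinate drops out of the form. *)
Lemma CM_form Gamma (v : 'cV[R]_d) (t : 'cV[R]_1) : \sum_i v i 0 = 0 ->
  ((col_mx v t)^T *m CM Gamma *m col_mx v t) 0 0 =
  - 2^-1 * (v^T *m Gamma *m v) 0 0.
Proof.
move=> v0; rewrite tr_col_mx mul_row_block mulmx0 addr0 mul_row_col.
rewrite mul_tr_ones v0 raddf0 mul0mx addr0 mulmxDl.
rewrite -[t^T *m _ *m v]mulmxA mul_ones v0 raddf0 mulmx0.
by rewrite addr0 -scalemxAr -scalemxAl mxE.
Qed.

Lemma cone_bordered_pos Gamma A :
  bordered_pos (apex d) (CM Gamma) (cone A) <-> cnd_on Gamma A.
Proof.
split=> [h v Av v0 sv | h x].
  have Ev : proj R (cone A) *m col_mx v 0 = col_mx v 0 by rewrite proj_cone Av.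
  have := h (col_mx v 0) Ev; rewrite CM_apex CM_form // => /(_ sv)[q0 q1].
  rewrite lt_neqAle; apply/andP; split; last by move: q0; lra.
  apply: contra v0 => /eqP vv; apply/eqP/matrixP => i j.
  rewrite mxE (ord1 j) -(col_mxEu v (0 : 'cV_1) i 0); apply: q1.
    by rewrite vv mulr0.
  by rewrite eq_sym -[apex d]/(rshift _ _) eq_rlshift.
rewrite -[x]vsubmxK proj_cone CM_apex => /eq_col_mx[Ax _] sx.
rewrite CM_form //.
have [x0|xn0] := eqVneq (usubmx x) 0.
  split=> [|_ i]; first by rewrite x0 mulmx0 mxE mulr0.
  elim/cone_ind: i => [i _|/negP//]; first by rewrite col_mxEu x0 mxE.
have := h _ Ax xn0 sx; split; first lra.
by lra.
Qed.

Lemma cnd_on_setT Gamma :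
  Gamma^T = Gamma -> (forall i, Gamma i i = 0) ->
  cnd_on Gamma setT <-> strictly_cnd Gamma.
Proof.
move=> Gs G0; split=> [h|[_ _ h] v _]; last exact: h.
by split=> // v; apply: h; rewrite proj_setT mul1mx.
Qed.

(** Nonemptiness matters: the bordered matrix of the empty set is the zero
    matrix of size one. *)
Lemma cone_inverse_exists Gamma A : Gamma^T = Gamma -> A != set0 ->
  cnd_on Gamma A -> exists J, local_inverse (CM Gamma) (cone A) J.
Proof.
move=> Gs /set0Pn[i iA] /cone_bordered_pos.
apply: (@bordered_pos_inverse _ _ (apex d) _ _ (lshift 1 i)).
- exact: CM_sym.
- exact: cone_apex.
- by rewrite cone_lshift.
- by rewrite CM_ur oner_neq0.
Qed.

(** The coordinate inclusion of [A], through which both [principal_sub] and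
    [embed] become matrix products. *)
Definition inclusion A : 'M[R]_(#|A|, d) :=
  \matrix_(k, i) (i == enum_val k)%:R.

Lemma inclusion_mulE m A (N : 'M[R]_(d, m)) k j :
  (inclusion A *m N) k j = N (enum_val k) j.
Proof.
rewrite mxE (bigD1 (enum_val k)) //= big1 => [|i /negbTE ik].
  by rewrite mxE eqxx mul1r addr0.
by rewrite mxE ik mul0r.
Qed.

Lemma mul_inclusion_trE m A (N : 'M[R]_(m, d)) i k :
  (N *m (inclusion A)^T) i k = N i (enum_val k).
Proof. by rewrite -[N *m _]trmxK [LHS]mxE trmx_mul trmxK inclusion_mulE mxE. Qed.

Lemma inclusionK A : inclusion A *m (inclusion A)^T = 1%:M.
Proof.
apply/matrixP => k l; rewrite inclusion_mulE !mxE.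
by rewrite (inj_eq enum_val_inj).
Qed.

Lemma inclusion_proj A : (inclusion A)^T *m inclusion A = proj R A.
Proof.
apply/matrixP => i j; rewrite !mxE.
have [iA|iA] := boolP (i \in A); last first.
  rewrite mul0rn big1 // => k _; rewrite !mxE.
  case: eqP => [ik|]; last by rewrite mul0r.
  by move: iA; rewrite ik enum_valP.
rewrite (bigD1 (enum_rank_in iA i)) //= !mxE enum_rankK_in // eqxx mul1r eq_sym.
rewrite big1 ?addr0 // => k ki; rewrite !mxE.
case: eqP => [ik|]; last by rewrite mul0r.
by case/eqP: ki; apply: enum_val_inj; rewrite enum_rankK_in.
Qed.

Lemma embedE A (N : 'M[R]_#|A|) :
  embed N = (inclusion A)^T *m N *m inclusion A.
Proof.
apply/matrixP => i j.
have [/andP[iA jA]|nA] := boolP ((i \in A) && (j \in A)).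
  rewrite -[i](enum_rankK_in iA) // -[j](enum_rankK_in iA) // embed_in.
  move: (enum_rank_in _ _) (enum_rank_in _ _) => k l.
  rewrite -(inclusion_mulE (_ *m _)) !mulmxA inclusionK mul1mx.
  by rewrite -[inclusion A]trmxK -mul_inclusion_trE trmxK -mulmxA inclusionK mulmx1.
rewrite embed_out //; move: nA; rewrite negb_and => /orP[iA|jA].
  rewrite -(trmxK (inclusion A)) -[X in X *m N]mulmx1 -inclusionK trmxK.
  by rewrite !mulmxA inclusion_proj -!mulmxA proj_mulE (negbTE iA).
rewrite -[in X in _ = X](mul1mx (inclusion A)) -inclusionK.
by rewrite -!mulmxA inclusion_proj !mulmxA mul_projE (negbTE jA).
Qed.

Definition cone_inclusion A : 'M[R]_(#|A| + 1, d + 1) :=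
  block_mx (inclusion A) 0 0 1%:M.

Lemma cone_inclusionK A : cone_inclusion A *m (cone_inclusion A)^T = 1%:M.
Proof.
rewrite tr_block_mx mulmx_block !trmx0 trmx1 !(mul0mx, mulmx0, mulmx1).
by rewrite !(addr0, add0r) inclusionK -scalar_mx_block.
Qed.

Lemma cone_inclusion_proj A :
  (cone_inclusion A)^T *m cone_inclusion A = proj R (cone A).
Proof.
rewrite tr_block_mx mulmx_block !trmx0 trmx1 !(mul0mx, mulmx0, mulmx1).
rewrite !(addr0, add0r) inclusion_proj; apply/matrixP => i j.
elim/cone_ind: i => [i|]; elim/cone_ind: j => [j|].
- by rewrite block_mxEul !mxE cone_lshift (inj_eq (@lshift_inj _ _)).
- by rewrite block_mxEur !mxE eq_lrshift.
- by rewrite block_mxEdl !mxE eq_rlshift.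
- by rewrite block_mxEdr !mxE cone_apex !eqxx.
Qed.

Lemma CM_inclusion Gamma A :
  CM (inclusion A *m Gamma *m (inclusion A)^T) =
  cone_inclusion A *m CM Gamma *m (cone_inclusion A)^T.
Proof.
rewrite tr_block_mx !mulmx_block !trmx0 trmx1.
rewrite !(mul0mx, mulmx0, mulmx1, mul1mx, addr0, add0r) /CM.
congr block_mx; first by rewrite -scalemxAr -scalemxAl.
  by apply/matrixP => k l; rewrite inclusion_mulE !mxE.
by apply/matrixP => k l; rewrite mul_inclusion_trE !mxE.
Qed.

(** [CM] of a submatrix is a submatrix of [CM], so the inverse taken inside
    matrices indexed by [A] and the local inverse on [cone A] correspond. *)
Lemma embed_theta Gamma A J :
  local_inverse (CM Gamma) (cone A) J ->
  embed (theta (inclusion A *m Gamma *m (inclusion A)^T)) = ulsubmx J.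
Proof.
set M := CM Gamma; set T := cone_inclusion A => hJ.
have TT : T *m T^T = 1%:M := cone_inclusionK A.
have PT : T^T *m T = proj R (cone A) := cone_inclusion_proj A.
have [EJ JE EMJ _] := hJ.
rewrite /theta CM_inclusion -/M -/T.
have inv : T *m M *m T^T *m (T *m J *m T^T) = 1%:M.
  rewrite !mulmxA -[_ *m T^T *m T]mulmxA PT -!mulmxA.
  rewrite [proj R _ *m _]mulmxA EJ.
  have -> : T *m (M *m (J *m T^T)) = T *m (proj R (cone A) *m M *m J) *m T^T.
    by rewrite !mulmxA -[T *m proj R _]mulmx1 -PT mulmxA TT mul1mx mulmx1.
  by rewrite EMJ -PT mulmxA TT mul1mx TT.
have -> : invmx (T *m M *m T^T) = T *m J *m T^T.
  have [u _] := mulmx1_unit inv.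
  by rewrite -[LHS]mulmx1 -inv mulKmx.
rewrite embedE.
have -> : ulsubmx J = ulsubmx (T^T *m (T *m J *m T^T) *m T).
  by rewrite !mulmxA PT EJ -mulmxA PT JE.
move: (T *m J *m T^T) => K.
rewrite -[K]submxK /T /cone_inclusion tr_block_mx !mulmx_block !trmx0 trmx1.
by rewrite !(mul0mx, mulmx0, mulmx1, mul1mx, addr0, add0r) !block_mxKul.
Qed.

Lemma theta_setT Gamma J :
  local_inverse (CM Gamma) (cone setT) J -> theta Gamma = ulsubmx J.
Proof.
rewrite coneT => -[_ _ + _]; rewrite proj_setT mul1mx => MJ.
have [u _] := mulmx1_unit MJ.
by rewrite /theta -[invmx _]mulmx1 -MJ mulKmx.
Qed.

End BorderedMatrices.

(** * Simplicial vertices of chordal graphs *)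

Lemma path_shortcut (T : Type) (e : rel T) (x : T) (p : seq T) (i j : nat) :
  path e x p -> (i.+1 < j <= size p)%N ->
  e (nth x (x :: p) i) (nth x (x :: p) j) ->
  path e x (take i p ++ drop j.-1 p) /\
  last x (take i p ++ drop j.-1 p) = last x p.
Proof.
case: j => [|j]; first by rewrite ltn0.
rewrite ltnS /= => xp /andP[ij jp] eij.
have := xp; rewrite -{1}(cat_take_drop i p) cat_path => /andP[xpi _].
have := xp; rewrite -{1}(cat_take_drop j p) cat_path => /andP[_].
rewrite cat_path xpi last_cat -[in RHS](cat_take_drop j p) last_cat.
have -> : last x (take i p) = nth x (x :: p) i.
  rewrite (last_nth x) size_takel; last by lia.
  by rewrite -[x :: take i p]/(take i.+1 (x :: p)) nth_take.
by rewrite (drop_nth x jp) /= eij => /andP[_ ->].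
Qed.

(** A path with a repetition or a chord can be shortened. *)
Lemma chordless_subpath (T : eqType) (e : rel T) (x : T) (p : seq T) :
  path e x p -> exists q, [/\ path e x q, last x q = last x p,
    {subset q <= p}, uniq (x :: q) &
    forall i j, (i.+1 < j <= size q)%N ->
      ~~ e (nth x (x :: q) i) (nth x (x :: q) j)].
Proof.
have [n] := ubnP (size p); elim: n p => // n IH p; rewrite ltnS => pn xp.
have [q xq uq sqp] := shortenP xp.
have qn : (size q <= n)%N.
  by apply: leq_trans pn; apply: uniq_leq_size => //; case/andP: uq.
pose chord (i j : 'I_(size q).+1) :=
  (i.+1 < j)%N && e (nth x (x :: q) i) (nth x (x :: q) j).
have [/existsP[i /existsP[j /andP[ij eij]]]|nochord] :=
  boolP [exists i, exists j, chord i j]; last first.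
  exists q; split=> // i j /andP[ij jq]; apply: contra nochord => eij.
  have iq : (i < (size q).+1)%N by lia.
  apply/existsP; exists (Ordinal iq); apply/existsP.
  by exists (Ordinal (jq : j < (size q).+1)%N); rewrite /chord ij.
have jq : (j <= size q)%N by rewrite -ltnS.
have [xq' lq'] := path_shortcut xq (introT andP (conj ij jq)) eij.
have [|r [xr lr rq' ur nr]] := IH (take i q ++ drop j.-1 q) _ xq'.
  apply: leq_trans qn; rewrite size_cat size_drop size_takel; lia.
exists r; split=> //; first by rewrite lr.
move=> y /rq'; rewrite mem_cat => /orP[/mem_take|/mem_drop]; exact: sqp.
Qed.

Section ChordalGraphs.
Variables (d : nat) (e : rel 'I_d).
Hypotheses (e_sym : symmetric e) (e_irr : irreflexive e).
Implicit Types (A B C W : {set 'I_d}).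

Lemma cliqueP C :
  reflect {in C &, forall x y, x != y -> e x y} (clique e C).
Proof.
apply: (iffP 'forall_in_forall_inP) => h x.
  by move=> y xC yC; apply/implyP/h.
by move=> xC y yC; apply/implyP/h.
Qed.

Lemma clique_sub A B : A \subset B -> clique e B -> clique e A.
Proof.
by move=> /subsetP AB /cliqueP h; apply/cliqueP => x y /AB xB /AB; apply: h.
Qed.

Definition induced W : rel 'I_d := [rel x y | [&& x \in W, y \in W & e x y]].

Definition connected_on W := {in W &, forall x y, connect (induced W) x y}.

(** [A :&: B] separates the two sides; the sides may be empty. *)
Definition separated A B := {in A :\: B & B :\: A, forall x y, ~~ e x y}.

Lemma path_induced W x p : path (induced W) x p -> {subset p <= W}.
Proof.
elim: p x => [|u p IH] x //= /andP[/and3P[_ uW _] /IH up] v.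
by rewrite in_cons => /orP[/eqP->|/up].
Qed.

Lemma connect_crossing (r : rel 'I_d) A x y : connect r x y ->
  x \in A -> y \notin A -> exists a b, [/\ a \in A, b \notin A & r a b].
Proof.
move=> /connectP[p]; elim: p x => [|u p IH] x /=; first by move=> _ -> ->.
case/andP=> xu up yl xA yA; have [uA|uA] := boolP (u \in A).
  exact: IH up yl uA yA.
by exists x, u.
Qed.

(** Sending the vertices outside [A] to a fixed vertex of the separator maps
    edges to edges or to single vertices, since the separator is a clique. *)
Lemma connected_on_retract A B : clique e (A :&: B) -> A :&: B != set0 ->
  separated A B -> connected_on (A :|: B) -> connected_on A.
Proof.
move=> /cliqueP clS /set0Pn[s sS] sep con x y xA yA.
pose f u := if u \in A then u else s.
have sA : s \in A by case/setIP: sS.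
have step u v : u \in A -> v \in B -> v \notin A -> e u v ->
    connect (induced A) u s /\ connect (induced A) s u.
  move=> uA vB vA uv; have uB : u \in B.
    apply: contraLR uv => uB; apply: sep; first by rewrite inE uB uA.
    by rewrite inE vA vB.
  have uS : u \in A :&: B by rewrite inE uA.
  have [->|us] := eqVneq u s; first by rewrite connect0.
  split; apply: connect1; rewrite /induced /= uA sA clS //.
  by rewrite eq_sym.
have fE u v : induced (A :|: B) u v -> connect (induced A) (f u) (f v).
  case/and3P; rewrite !inE /f => uAB vAB uv.
  have [uA|uA] := boolP (u \in A); have [vA|vA] := boolP (v \in A).
  - by apply: connect1; rewrite /induced /= uA vA.
  - rewrite (negbTE vA) /= in vAB; exact: (step u v uA vAB vA uv).1.
  - rewrite (negbTE uA) /= in uAB; rewrite e_sym in uv.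
    exact: (step v u vA uAB uA uv).2.
  - exact: connect0.
have -> : x = f x by rewrite /f xA.
have -> : y = f y by rewrite /f yA.
have /connectP[p] := con x y (subsetP (subsetUl A B) x xA)
                             (subsetP (subsetUl A B) y yA).
elim: p (x) => [|v p IH] u /=; first by move=> _ ->; apply: connect0.
by case/andP=> uv /IH h /h; apply: connect_trans; apply: fE.
Qed.

Definition nbrs W v := [set u in W | e v u].

(** A chordless path closed up by a vertex adjacent only to its endpoints is a
    chordless cycle. *)
Lemma chordless_cycle_false z x p : chordal e -> path e x p ->
  uniq (z :: x :: p) -> (1 < size p)%N ->
  e z x -> e z (last x p) ->
  {in x :: p, forall u, e z u -> u = x \/ u = last x p} ->
  (forall i j, (i.+1 < j <= size p)%N ->
      ~~ e (nth x (x :: p) i) (nth x (x :: p) j)) -> False.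
Proof.
move=> chG xp us sp zx zy onlyz nochord; set s := z :: x :: p in us.
have ucs : ucycle e s.
  by rewrite /ucycle us /s /= zx rcons_path xp e_sym zy.
have [|a [b [aS bS ab ba ab']]] := chG s ucs; first by rewrite /=; lia.
have nextE c : c \in s -> next s c = nth z s (index c s).+1.
  by move=> cs; rewrite next_nth cs.
wlog ij : a b aS bS ab ba ab' / (index a s < index b s)%N.
  move=> wl; case: (ltngtP (index a s) (index b s)) => ij.
  - exact: (wl a b).
  - by apply: (wl b a) => //; rewrite e_sym.
  - have eq_ab : a = b by rewrite -(nth_index z aS) ij nth_index.
    by rewrite eq_ab e_irr in ab.
have jn : (index b s < size s)%N by rewrite index_mem.
move: ba; rewrite (nextE a aS) => ba.
have ij2 : ((index a s).+1 < index b s)%N.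
  rewrite ltn_neqAle ij andbT; apply: contraNneq ba => ->.
  by rewrite nth_index.
case ia: (index a s) => [|i] in ij ij2.
  have az : a = z by rewrite -(nth_index z aS) ia.
  have bxp : b \in x :: p.
    move: bS; rewrite /s in_cons => /orP[/eqP bz|//].
    by rewrite az bz e_irr in ab.
  case: (onlyz b bxp); first by rewrite -az.
    by move=> bx; move: ij2; rewrite bx /s /= eqxx; case: eqP => // ->.
  move=> bl; move/eqP: ab'; apply; rewrite az (nextE b bS).
  have -> : index b s = (size p).+1.
    rewrite bl (last_nth z) -[nth z (x :: p) _]/(nth z s (size p).+1).
    by rewrite index_uniq.
  by rewrite nth_default.
case jb: (index b s) => [|j] in ij ij2 jn; first by [].
have {}nochord : ~~ e (nth x (x :: p) i) (nth x (x :: p) j).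
  by apply: nochord; move: ij2 jn; rewrite /s /=; lia.
have ia' : nth x (x :: p) i = a.
  rewrite -(nth_index z aS) ia /s [RHS]/= (set_nth_default z) //.
  by move: ij2 jn; rewrite /s /=; lia.
have jb' : nth x (x :: p) j = b.
  rewrite -(nth_index z bS) jb /s [RHS]/= (set_nth_default z) //.
by rewrite ia' jb' ab in nochord.
Qed.

(** A form of Dirac's theorem.  Let [C] be a component of the non-neighbours of
    [z] and [S] the vertices of [W] next to [C]; they are neighbours of [z].
    Two non-adjacent vertices of [S] would be joined by a chordless path
    through [C], which [z] closes up, so [S] is a clique.  The induction
    applied to [C :|: S], which misses [z], provides a simplicial vertex in
    [C], and all its neighbours in [W] lie in [C :|: S]. *)
Lemma simplicial_nonneighbour z W : chordal e -> z \in W ->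
  (exists2 w, w \in W & (w != z) && ~~ e z w) ->
  exists2 v, v \in W & [/\ v != z, ~~ e z v & clique e (nbrs W v)].
Proof.
move=> chG; have [n] := ubnP #|W|; elim: n z W => // n IH z W.
rewrite ltnS => Wn zW [w wW /andP[wz zw]].
pose D := [set u in W | (u != z) && ~~ e z u].
have wD : w \in D by rewrite inE wW wz.
pose C := [set u | connect (induced D) w u].
have wC : w \in C by rewrite inE connect0.
have CD : C \subset D.
  apply/subsetP => u; rewrite inE => wu; apply: contraT => uD.
  have [a [b [_ bD /and3P[_ bD' _]]]] := connect_crossing wu wD uD.
  by rewrite bD' in bD.
have DW : D \subset W by apply/subsetP => u; rewrite inE => /andP[].
pose S := [set u in W | e z u & [exists c in C, e c u]].
have nbrC c u : c \in C -> u \in W -> e c u -> u \in C :|: S.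
  move=> cC uW cu; have /(subsetP CD) cD := cC.
  have [_ /andP[cz zc]] := setIdP cD.
  have uz : u != z by apply: contraNneq zc => <-; rewrite e_sym.
  have [zu|zu] := boolP (e z u); rewrite in_setU.
    apply/orP; right; rewrite inE uW zu; apply/existsP; exists c.
    by rewrite cC.
  apply/orP; left; rewrite inE.
  apply: connect_trans (_ : connect _ w c) _; first by rewrite inE in cC.
  by apply: connect1; rewrite /induced /= cD cu inE uW uz zu.
have clS : clique e S.
  apply/cliqueP => x y xS yS xy; apply: contraT => nexy.
  have [xW /andP[zx /existsP[c1 /andP[c1C c1x]]]] := setIdP xS.
  have [yW /andP[zy /existsP[c2 /andP[c2C c2y]]]] := setIdP yS.
  have /connectP[p c1p c2l] : connect (induced D) c1 c2.
    apply: connect_trans (_ : connect _ c1 w) _; last by rewrite inE in c2C.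
    rewrite sym_connect_sym; first by rewrite inE in c1C.
    by move=> u v; rewrite /induced /= e_sym andbCA.
  have pD u : u \in c1 :: p -> u \in D.
    by rewrite in_cons => /orP[/eqP->|/(path_induced c1p)//]; apply: (subsetP CD).
  have xp : path e x (c1 :: rcons p y).
    rewrite /= e_sym c1x rcons_path -c2l c2y andbT.
    by apply: sub_path c1p => u v /and3P[].
  have [q [xq lq sq uq nq]] := chordless_subpath xp.
  have {}lq : last x q = y by rewrite lq /= last_rcons.
  have qD u : u \in q -> u \in D \/ u = y.
    move/sq; rewrite -rcons_cons mem_rcons in_cons => /orP[/eqP|/pD].
      by right.
    by left.
  exfalso; apply: (@chordless_cycle_false z x q) => //.
  - rewrite cons_uniq uq andbT in_cons negb_or; apply/andP; split.
      by apply: contraTneq zx => <-; rewrite e_irr.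
    apply/negP => /qD[|zy']; first by rewrite inE eqxx andbF.
    by move: zy; rewrite -zy' e_irr.
  - case: (q) lq xq => [|u [|v r]] //=.
      by move=> xy'; rewrite xy' eqxx in xy.
    by move=> -> ; rewrite (negbTE nexy).
  - by rewrite lq.
  move=> u; rewrite in_cons lq => /orP[/eqP -> _|/qD[|-> _]]; [by left| |by right].
  by rewrite inE => /and3P[_ _ /negbTE ->].
pose H := C :|: S.
have HW : H \subset W.
  rewrite subUset (subset_trans CD DW); apply/subsetP => u.
  by rewrite inE => /andP[].
have zH : z \notin H.
  apply/negP; rewrite inE => /orP[/(subsetP CD)|]; rewrite inE.
    by rewrite eqxx andbF.
  by rewrite e_irr andbF.
have Hn : (#|H| < n)%N.
  apply: leq_trans Wn; apply: proper_card; apply/properP; split=> //.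
  by exists z.
suff [v vC clv] : exists2 v, v \in C & clique e (nbrs H v).
  have vD := subsetP CD v vC; exists v; first exact: (subsetP DW).
  have [_ /andP[vz zv]] := setIdP vD; split=> //.
  apply: clique_sub clv; apply/subsetP => u /setIdP[uW vu].
  by apply/setIdP; split=> //; apply: nbrC vu.
have [|noS] := boolP [exists s in S, exists h in H, (h != s) && ~~ e s h].
  move=> /existsP[s /andP[sS /existsP[h /andP[hH hs]]]].
  have sH : s \in H by apply/setUP; right.
  have [|v vH [vs sv clv]] := IH s H Hn sH; first by exists h.
  exists v => //; have [//|vS] := setUP vH.
  by move/cliqueP: clS sv => ->; rewrite // eq_sym.
have adjS s h : s \in S -> h \in H -> h != s -> e s h.
  move=> sS hH hs; apply: contraNT noS => sh; apply/existsP; exists s.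
  by rewrite sS; apply/existsP; exists h; rewrite hH hs.
have [|noC] := boolP [exists c in C, exists h in H, (h != c) && ~~ e c h].
  move=> /existsP[c /andP[cC /existsP[h /andP[hH hc]]]].
  have cH : c \in H by apply/setUP; left.
  have [|v vH [vc cv clv]] := IH c H Hn cH; first by exists h.
  exists v => //; have [//|vS] := setUP vH.
  by move: cv; rewrite e_sym adjS // eq_sym.
exists w => //; apply/cliqueP => u v /setIdP[uH _] /setIdP[vH _] uv.
have [uC|uS] := setUP uH.
  apply: contraNT noC => nuv; apply/existsP; exists u; rewrite uC.
  by apply/existsP; exists v; rewrite vH eq_sym uv.
by apply: adjS => //; rewrite eq_sym.
Qed.

End ChordalGraphs.

(** * Clique decompositions of connected chordal graphs *)

Section Decompositions.
Variables (d : nat) (e : rel 'I_d).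
Hypotheses (e_sym : symmetric e) (e_irr : irreflexive e).
Implicit Types (A B C W : {set 'I_d}).

(** Elimination of a simplicial vertex [v], with [B] the vertex [v] and its
    neighbours; connectedness makes [A :&: B] nonempty and passes to [A]. *)
Lemma chordal_connected_ind (K : {set 'I_d} -> Prop) : chordal e ->
  (forall C, C != set0 -> clique e C -> K C) ->
  (forall A B, clique e B -> A :&: B != set0 -> separated e A B ->
     K A -> K (A :|: B)) ->
  forall W, W != set0 -> connected_on e W -> K W.
Proof.
move=> chG Kcl Kglue W; have [n] := ubnP #|W|; elim: n W => // n IH W.
rewrite ltnS => Wn W0 con.
have [clW|] := boolP (clique e W); first exact: Kcl.
rewrite negb_forall_in => /exists_inP[z zW]; rewrite negb_forall_in.
move=> /exists_inP[w wW]; rewrite negb_imply eq_sym => zw.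
have [|v vW [vz zv clv]] := simplicial_nonneighbour e_sym e_irr chG zW.
  by exists w.
pose A := W :\ v; pose B := v |: nbrs e W v.
have vB : v \in B by rewrite setU11.
have nB u : u \in nbrs e W v -> u \in B by move=> uN; rewrite inE uN orbT.
have AB : A :&: B = nbrs e W v.
  apply/setP => u; rewrite !inE; have [->|uv] := eqVneq u v.
    by rewrite /= e_irr andbF.
  by case: (u \in W).
have AUB : A :|: B = W.
  apply/setP => u; rewrite !inE; have [->|uv] := eqVneq u v; first by rewrite vW.
  by case: (u \in W).
have clB : clique e B.
  apply/cliqueP => x y /setU1P[->|xN] /setU1P[->|yN].
  - by rewrite eqxx.
  - by case/setIdP: yN.
  - by case/setIdP: xN; rewrite e_sym.
  - by move: xN yN; move/cliqueP: clv; apply.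
have sep : separated e A B.
  move=> x y /setDP[xA xB] /setDP[yB yA].
  have [_ xW] := setD1P xA.
  have -> : y = v.
    case/setU1P: yB => // /setIdP[yW vy]; apply: contraNeq yA => yv.
    by rewrite in_setD1 yv.
  by apply: contra xB; rewrite e_sym => vx; apply/nB/setIdP.
have AB0 : A :&: B != set0.
  have := @connect_crossing _ (induced e W) [set v] v z (con v z vW zW).
  rewrite !inE eq_sym => /(_ (eqxx _) vz)[a [b [/set1P-> _ /and3P[_ bW vb]]]].
  by apply/set0Pn; exists b; rewrite AB inE bW.
have conA : connected_on e A.
  apply: (connected_on_retract e_sym _ AB0 sep); last by rewrite AUB.
  by apply: clique_sub clB; apply: subsetIr.
rewrite -AUB; apply: Kglue => //; apply: IH => //.
  by apply: leq_trans Wn; rewrite (cardsD1 v W) vW.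
by apply: contraNneq AB0 => ->; rewrite set0I.
Qed.

Lemma connected_graph_on : connected_graph e -> connected_on e setT.
Proof.
move=> [_ con] x y _ _; rewrite -(@eq_connect _ e) // => u v.
by rewrite /induced /= !inE.
Qed.

Lemma clique1 x : clique e [set x].
Proof. by apply/cliqueP => u v /set1P-> /set1P->; rewrite eqxx. Qed.

Lemma clique2 x y : e x y -> clique e [set x; y].
Proof.
move=> xy; apply/cliqueP => u v /set2P[]-> /set2P[]->; rewrite ?eqxx //.
by rewrite e_sym.
Qed.

Lemma max_cliqueP C : C \in max_cliques e -> clique e C.
Proof. by rewrite inE => /maxsetp. Qed.

Lemma max_clique_neq0 C : (0 < d)%N -> C \in max_cliques e -> C != set0.
Proof.
move=> d0; rewrite inE => /maxsetP[_ mx]; apply/eqP => C0.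
have := mx [set Ordinal d0] (clique1 _); rewrite C0 sub0set => /(_ isT).
by move/setP/(_ (Ordinal d0)); rewrite !inE eqxx.
Qed.

End Decompositions.

Section PerfectSequences.
Variables (d : nat) (e : rel 'I_d) (cs : seq {set 'I_d}).
Hypotheses (e_sym : symmetric e) (e_irr : irreflexive e).
Hypotheses (e_conn : connected_graph e) (perf : perfect_sequence e cs).

Let C k := nth set0 cs k.

Definition prefix_union k := \bigcup_(l < k) nth set0 cs l.

Lemma prefix_unionS k : prefix_union k.+1 = prefix_union k :|: C k.
Proof. by rewrite /prefix_union big_ord_recr. Qed.

Lemma separatorE k : separator cs k = prefix_union k :&: C k.
Proof. exact: setIC. Qed.

Lemma prefix_unionP k x :
  reflect (exists2 i, (i < k)%N & x \in C i) (x \in prefix_union k).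
Proof.
apply: (iffP bigcupP) => [[i _ xi]|[i ik xi]]; first by exists i.
by exists (Ordinal ik).
Qed.

Lemma mem_perfect A : (A \in cs) = (A \in max_cliques e).
Proof. by case: perf => pe _; rewrite (perm_mem pe) mem_enum. Qed.

Lemma perfect_clique k : clique e (C k).
Proof.
have [kc|kc] := ltnP k (size cs).
  by apply: max_cliqueP; rewrite -mem_perfect mem_nth.
by rewrite /C nth_default //; apply/cliqueP => x y; rewrite inE.
Qed.

Lemma cover_clique A : clique e A -> exists2 i, (i < size cs)%N & A \subset C i.
Proof.
move=> /maxset_exists[B mB AB].
have Bcs : B \in cs by rewrite mem_perfect inE.
by exists (index B cs); rewrite ?index_mem // /C nth_index.
Qed.

Lemma size_perfect_gt0 : (0 < size cs)%N.
Proof.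
case: e_conn => d0 _; have [i ic _] := cover_clique (clique1 e (Ordinal d0)).
exact: leq_ltn_trans ic.
Qed.

Lemma prefix_union_size : prefix_union (size cs) = setT.
Proof.
apply/setP => x; rewrite inE; apply/prefix_unionP.
have [i ic xi] := cover_clique (clique1 e x); exists i => //.
by apply: (subsetP xi); rewrite inE.
Qed.

(** The invariant to carry along the prefixes: an edge of the graph within the
    union of a prefix could a priori come from a later clique only. *)
Definition edges_covered k := {in prefix_union k &, forall x y, e x y ->
  exists2 i, (i < k)%N & (x \in C i) && (y \in C i)}.

(** An edge from outside the clique [C k] to outside the preceding ones would
    lie in none of the cliques up to [C k].  The separator is nonempty because a
    connected graph has an edge that leaves the preceding cliques, and this
    edge lies in [C k].  An edge covered only by [C k] but contained in the
    preceding cliques lies in the separator, hence in an earlier clique by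
    perfection. *)
Lemma perfect_step k : (0 < k < size cs)%N ->
  edges_covered k.+1 -> connected_on e (prefix_union k.+1) ->
  [/\ separated e (prefix_union k) (C k), prefix_union k :&: C k != set0,
      edges_covered k & connected_on e (prefix_union k)].
Proof.
move=> /andP[k0 kc] cov con.
have sub i : (i < k)%N -> C i \subset prefix_union k.
  by move=> ik; apply/subsetP => x xi; apply/prefix_unionP; exists i.
have inS x : x \in prefix_union k -> x \in prefix_union k.+1.
  by move=> xk; rewrite prefix_unionS inE xk.
have inC x : x \in C k -> x \in prefix_union k.+1.
  by move=> xk; rewrite prefix_unionS inE xk orbT.
have sep : separated e (prefix_union k) (C k).
  move=> x y /setDP[xU xC] /setDP[yC yU]; apply/negP => xy.
  have [i] := cov x y (inS x xU) (inC y yC) xy.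
  rewrite ltnS leq_eqVlt => /orP[/eqP->|ik] /andP[xi yi].
    by rewrite xi in xC.
  by rewrite (subsetP (sub i ik) y yi) in yU.
have C0 i : (i < size cs)%N -> C i != set0.
  move=> ic; apply: (@max_clique_neq0 d e); first by case: e_conn.
  by rewrite -mem_perfect mem_nth.
have S0 : prefix_union k :&: C k != set0.
  have /set0Pn[x xC0] := C0 0 size_perfect_gt0.
  have /set0Pn[y yC] := C0 k kc.
  have xU : x \in prefix_union k by apply: subsetP xC0; apply: sub.
  have [yU|yU] := boolP (y \in prefix_union k).
    by apply/set0Pn; exists y; rewrite inE yU.
  have [a [b [aU bU /and3P[_ bU' ab]]]] :=
    connect_crossing (con x y (inS x xU) (inC y yC)) xU yU.
  have bC : b \in C k by move: bU'; rewrite prefix_unionS inE (negbTE bU).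
  have aC : a \in C k.
    by apply: contraLR ab => aC; apply: sep; rewrite inE ?aC ?bU.
  by apply/set0Pn; exists a; rewrite inE aU.
split=> //; last first.
  apply: (connected_on_retract e_sym _ S0 sep); last by rewrite -prefix_unionS.
  by apply: clique_sub (perfect_clique k); apply: subsetIr.
move=> x y xU yU xy; have [i] := cov x y (inS x xU) (inS y yU) xy.
rewrite ltnS leq_eqVlt => /orP[/eqP->|ik]; last by exists i.
case/andP=> xC yC; have [_ /(_ k)] := perf; rewrite k0 kc => /(_ isT)[j jk sepE].
have inj z : z \in prefix_union k -> z \in C k -> z \in C j.
  move=> zU zC; have : z \in separator cs k by rewrite separatorE inE zU.
  by rewrite sepE => /setIP[].
by exists j => //; rewrite !inj.
Qed.

(** Descending induction: the whole sequence covers all edges of a connected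
    graph, and [perfect_step] removes one clique at a time. *)
Lemma perfect_prefix k : (0 < k <= size cs)%N ->
  edges_covered k /\ connected_on e (prefix_union k).
Proof.
move=> /andP[k0 kc]; have [n] := ubnP (size cs - k).
elim: n k k0 kc => // n IH k k0 kc.
rewrite ltnS => kn; move: kc; rewrite leq_eqVlt => /orP[/eqP->|kc].
  split; last by rewrite prefix_union_size; apply: connected_graph_on.
  move=> x y _ _ xy; have [i ic xyi] := cover_clique (clique2 e_sym xy).
  exists i => //.
  by apply/andP; split; apply: (subsetP xyi); rewrite !inE eqxx ?orbT.
have [|||cov con] := IH k.+1; rewrite //; first by lia.
by have [|] := perfect_step _ cov con; first by rewrite k0.
Qed.

End PerfectSequences.

(** * Gluing variograms along a common part *)

Section Gluing.
Variables (R : realFieldType) (d : nat).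
Implicit Types (A B : {set 'I_d}) (Gamma : 'M[R]_d).

Definition agree_on A Gamma Gamma' :=
  {in A &, forall i j, Gamma i j = Gamma' i j}.

Lemma agree_on_sub A B Gamma Gamma' :
  A \subset B -> agree_on B Gamma Gamma' -> agree_on A Gamma Gamma'.
Proof. by move=> /subsetP AB h i j /AB iB /AB; apply: h. Qed.

Lemma agree_on_CM A Gamma Gamma' : agree_on A Gamma Gamma' ->
  proj R (cone A) *m CM Gamma *m proj R (cone A) =
  proj R (cone A) *m CM Gamma' *m proj R (cone A).
Proof.
move=> h; apply/matrixP => i j; rewrite !mul_projE !proj_mulE.
elim/cone_ind: i => [i|]; elim/cone_ind: j => [j|];
  rewrite ?cone_lshift ?cone_apex ?CM_ul ?CM_ur ?CM_dl ?CM_dr //.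
by case: ifP => // jA; case: ifP => // iA; rewrite h.
Qed.

Lemma agree_on_local_inverse A Gamma Gamma' J : agree_on A Gamma Gamma' ->
  local_inverse (CM Gamma) (cone A) J -> local_inverse (CM Gamma') (cone A) J.
Proof. by move=> /agree_on_CM; apply: local_inverse_ext. Qed.

Lemma agree_on_cnd A Gamma Gamma' : agree_on A Gamma Gamma' ->
  cnd_on Gamma A -> cnd_on Gamma' A.
Proof.
move=> /agree_on_CM h /cone_bordered_pos hA; apply/cone_bordered_pos.
exact: bordered_pos_ext (cone_apex A) h hA.
Qed.

Lemma cnd_on_sub A B Gamma : A \subset B -> cnd_on Gamma B -> cnd_on Gamma A.
Proof. by move=> AB h v Av; apply: h; apply: proj_mul_sub Av. Qed.

Lemma agree_on_cross A B Gamma Gamma' J :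
  agree_on A Gamma Gamma' -> agree_on B Gamma Gamma' ->
  proj R (cone (A :&: B)) *m J = J -> J *m proj R (cone (A :&: B)) = J ->
  proj R (cone A) *m (CM Gamma *m J *m CM Gamma) *m proj R (cone B) =
  proj R (cone A) *m (CM Gamma' *m J *m CM Gamma') *m proj R (cone B).
Proof.
move=> /agree_on_CM hA /agree_on_CM hB EJ JE.
have JA := proj_mul_sub (cone_sub (subsetIl A B)) EJ.
have JB := mul_proj_sub (cone_sub (subsetIr A B)) JE.
have split_mid (N : 'M[R]_(d + 1)) :
    proj R (cone A) *m (N *m J *m N) *m proj R (cone B) =
    (proj R (cone A) *m N *m proj R (cone A)) *m J *m
    (proj R (cone B) *m N *m proj R (cone B)).
  by rewrite -{1}JA -{1}JB !mulmxA.
by rewrite !split_mid hA hB.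
Qed.

Lemma cone_setD A B i :
  i \in cone A :\: cone B -> exists2 j, j \in A :\: B & i = lshift 1 j.
Proof.
elim/cone_ind: i => [j|]; last by rewrite inE cone_apex.
by rewrite inE !cone_lshift -in_setD => jAB; exists j.
Qed.

Lemma decoupled_coneP A B Gamma J :
  decoupled (CM Gamma) (cone A) (cone B) J <->
  {in A :\: B & B :\: A, forall i j, CM Gamma (lshift 1 i) (lshift 1 j) =
     (CM Gamma *m J *m CM Gamma) (lshift 1 i) (lshift 1 j)}.
Proof.
split=> [h i j iAB jBA | h].
  have /matrixP /(_ (lshift 1 i) (lshift 1 j)) := h.
  rewrite mul_projE proj_mulE !in_setD !cone_lshift -!in_setD iAB jBA.
  by rewrite mxE [X in _ + X]mxE [RHS]mxE => /eqP; rewrite subr_eq0 => /eqP.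
apply/matrixP => i j; rewrite mul_projE proj_mulE [RHS]mxE.
case: ifP => // /cone_setD[j' jBA ->]; case: ifP => // /cone_setD[i' iAB ->].
by rewrite mxE [X in _ + X]mxE h // subrr.
Qed.

(** The decoupling equation determines the entries between the two sides from
    those within [A] and within [B]. *)
Lemma decoupled_unique A B Gamma Gamma' J :
  agree_on A Gamma Gamma' -> agree_on B Gamma Gamma' ->
  local_inverse (CM Gamma) (cone (A :&: B)) J ->
  decoupled (CM Gamma) (cone A) (cone B) J ->
  decoupled (CM Gamma') (cone A) (cone B) J ->
  {in A :\: B & B :\: A, forall i j, Gamma i j = Gamma' i j}.
Proof.
move=> hA hB [EJ JE _ _] /decoupled_coneP d1 /decoupled_coneP d2 i j iAB jBA.
have := d2 i j iAB jBA; have := d1 i j iAB jBA; rewrite !CM_ul.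
have /matrixP /(_ (lshift 1 i) (lshift 1 j)) := agree_on_cross hA hB EJ JE.
have [iA _] := setDP iAB; have [jB _] := setDP jBA.
rewrite !mul_projE !proj_mulE !cone_lshift iA jB => -> h1 h2.
by have := etrans h1 (esym h2); lra.
Qed.

(** Overwriting the entries between the two sides by the values that the
    decoupling equation imposes does not change that equation, whose right-hand
    side only involves entries within [A] and within [B]. *)
Lemma glue_exists A B Gamma JS : Gamma^T = Gamma -> (forall i, Gamma i i = 0) ->
  local_inverse (CM Gamma) (cone (A :&: B)) JS ->
  exists Gamma', [/\ Gamma'^T = Gamma', forall i, Gamma' i i = 0,
    agree_on A Gamma Gamma', agree_on B Gamma Gamma' &
    decoupled (CM Gamma') (cone A) (cone B) JS].
Proof.
move=> Gs G0 hS; have Js := local_inverse_tr (CM_sym Gs) hS.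
pose N := CM Gamma *m JS *m CM Gamma.
have Ns i j : N i j = N j i.
  have /matrixP /(_ j i) : N^T = N by rewrite !trmx_mul Js CM_sym // mulmxA.
  by rewrite mxE.
pose cross i j := (i \in A :\: B) && (j \in B :\: A).
pose Gamma' : 'M[R]_d := \matrix_(i, j)
  if cross i j || cross j i then - 2 * N (lshift 1 i) (lshift 1 j)
  else Gamma i j.
have hA : agree_on A Gamma Gamma'.
  by move=> i j iA jA; rewrite mxE /cross !inE iA jA /= !andbF.
have hB : agree_on B Gamma Gamma'.
  by move=> i j iB jB; rewrite mxE /cross !inE iB jB.
exists Gamma'; split=> //.
- apply/matrixP => i j; rewrite [LHS]mxE [LHS]mxE [RHS]mxE orbC Ns.
  by case: ifP => // _; rewrite -[in LHS]Gs mxE.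
- by move=> i; rewrite mxE /cross !inE; case: (i \in A); case: (i \in B); rewrite /= G0.
apply/decoupled_coneP => i j iAB jBA.
case: hS => EJ JE _ _.
have /matrixP /(_ (lshift 1 i) (lshift 1 j)) := agree_on_cross hA hB EJ JE.
have [iA _] := setDP iAB; have [jB _] := setDP jBA.
rewrite !mul_projE !proj_mulE !cone_lshift iA jB => <-; rewrite -/N.
by rewrite CM_ul mxE /cross iAB jBA /=; lra.
Qed.

Lemma glue_inverse A B Gamma JA JB JS : Gamma^T = Gamma ->
  local_inverse (CM Gamma) (cone A) JA -> local_inverse (CM Gamma) (cone B) JB ->
  local_inverse (CM Gamma) (cone (A :&: B)) JS ->
  decoupled (CM Gamma) (cone A) (cone B) JS ->
  local_inverse (CM Gamma) (cone (A :|: B)) (JA + JB - JS).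
Proof.
move=> Gs hA hB; rewrite coneI coneU => hS.
exact: local_inverseU (CM_sym Gs) hA hB hS.
Qed.

Lemma glue_cnd A B Gamma JS : Gamma^T = Gamma ->
  cnd_on Gamma A -> cnd_on Gamma B ->
  local_inverse (CM Gamma) (cone (A :&: B)) JS ->
  decoupled (CM Gamma) (cone A) (cone B) JS -> cnd_on Gamma (A :|: B).
Proof.
move=> Gs /cone_bordered_pos hA /cone_bordered_pos hB hS dec.
apply/cone_bordered_pos; rewrite coneU; rewrite coneI in hS.
apply: bordered_posU (CM_sym Gs) _ hS dec hA hB.
by rewrite inE !cone_apex.
Qed.

End Gluing.

(** * Completion of partial variograms *)

Section Completions.
Variables (R : realFieldType) (d : nat) (e : rel 'I_d) (P : 'M[option R]_d).
Hypothesis pvP : partial_variogram e P.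
Implicit Types (A B C W : {set 'I_d}) (Gamma : 'M[R]_d).

Definition zero_on_nonedges W (J : 'M[R]_(d + 1)) := {in W &, forall i j,
  i != j -> ~~ e i j -> J (lshift 1 i) (lshift 1 j) = 0}.

(** The completion problem of the graph induced on [W], for matrices of full
    size whose off-diagonal entries outside [W] are only required to be
    symmetric; [solves_completion] is the case of the full vertex set. *)
Definition solves_on Gamma W :=
  [/\ Gamma^T = Gamma, forall i, Gamma i i = 0, cnd_on Gamma W,
      {in W &, forall i j, e i j -> P i j = Some (Gamma i j)} &
      forall J, local_inverse (CM Gamma) (cone W) J -> zero_on_nonedges W J].

(** Carries the specified entries; the zeros at the unspecified ones are
    placeholders. *)
Definition default_completion : 'M[R]_d := \matrix_(i, j) odflt 0 (P i j).

Lemma solves_on_clique Gamma W C : solves_on Gamma W -> clique e C ->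
  C \subset W -> agree_on C default_completion Gamma.
Proof.
case: pvP => _ P0 _ _ [_ G0 _ GP _] /cliqueP clC /subsetP CW i j iC jC.
rewrite mxE; have [<-|ij] := eqVneq i j; first by rewrite P0 G0.
by rewrite (GP _ _ (CW i iC) (CW j jC)) // clC.
Qed.

Lemma principal_sub_inclusion C Gamma : agree_on C default_completion Gamma ->
  principal_sub P C = inclusion R C *m Gamma *m (inclusion R C)^T.
Proof.
move=> h; apply/matrixP => k l; rewrite mul_inclusion_trE inclusion_mulE.
by rewrite -h ?enum_valP // !mxE.
Qed.

Lemma clique_cnd_on C : clique e C -> cnd_on default_completion C.
Proof.
case: pvP => _ _ _ /[apply] -[_ _ h] v Cv v0 sv.
rewrite (@principal_sub_inclusion C default_completion) // in h.
pose w := inclusion R C *m v.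
have vw : (inclusion R C)^T *m w = v by rewrite mulmxA inclusion_proj.
have w0 : w != 0 by apply: contraNneq v0 => w0; rewrite -vw w0 mulmx0.
have sw : \sum_k w k 0 = 0.
  rewrite -[RHS]sv [RHS](bigID (mem C)) /= [X in _ + X]big1 ?addr0 => [|i iC].
    by rewrite [RHS]big_enum_val; apply: eq_bigr => k _; rewrite inclusion_mulE.
  by rewrite -Cv proj_mulE (negbTE iC).
suff -> : v^T *m default_completion *m v =
  w^T *m (inclusion R C *m default_completion *m (inclusion R C)^T) *m w.
  exact: h.
by rewrite -[in LHS]vw trmx_mul trmxK !mulmxA.
Qed.

Lemma default_sym : default_completion^T = default_completion.
Proof.
by case: pvP => Ps _ _ _; apply/matrixP => i j; rewrite !mxE -[in LHS]Ps mxE.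
Qed.

Lemma default_diag i : default_completion i i = 0.
Proof. by case: pvP => _ P0 _ _; rewrite mxE P0. Qed.

Lemma default_edge i j : e i j -> i != j ->
  P i j = Some (default_completion i j).
Proof.
case: pvP => _ _ Pe _ eij ij; rewrite mxE; have := Pe i j ij.
by case: (P i j) => //; rewrite eij.
Qed.

Lemma solves_on_ext A Gamma Gamma' : Gamma'^T = Gamma' ->
  (forall i, Gamma' i i = 0) -> agree_on A Gamma Gamma' ->
  solves_on Gamma A -> solves_on Gamma' A.
Proof.
move=> Gs G0 h [_ _ cA PA JA]; split=> //; first exact: agree_on_cnd cA.
  by move=> i j iA jA eij; rewrite -h // PA.
move=> J hJ; apply: JA; apply: agree_on_local_inverse hJ.
by move=> i j iA jA; rewrite h.
Qed.

Lemma local_inverse_lshift_out Gamma A J i j :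
  local_inverse (CM Gamma) (cone A) J -> ~~ ((i \in A) && (j \in A)) ->
  J (lshift 1 i) (lshift 1 j) = 0.
Proof. by move=> hJ nA; apply: local_inverse_out hJ _; rewrite !cone_lshift. Qed.

Lemma solves_on_inverse A Gamma : A != set0 -> solves_on Gamma A ->
  exists J, local_inverse (CM Gamma) (cone A) J.
Proof. by move=> A0 [Gs _ cA _ _]; apply: cone_inverse_exists. Qed.

(** The inverse on the union vanishes between the two sides, as these are not
    adjacent; so it is [JA + JB - JS].  At a non-edge within [A] the terms [JB]
    and [JS] vanish, because [B] is a clique, and [JA] inherits the zeros. *)
Lemma solves_on_split A B Gamma : clique e B -> A :&: B != set0 ->
  separated e A B -> solves_on Gamma (A :|: B) ->
  solves_on Gamma A /\ exists JA JB JS,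
    [/\ local_inverse (CM Gamma) (cone A) JA,
        local_inverse (CM Gamma) (cone B) JB,
        local_inverse (CM Gamma) (cone (A :&: B)) JS,
        decoupled (CM Gamma) (cone A) (cone B) JS &
        local_inverse (CM Gamma) (cone (A :|: B)) (JA + JB - JS)].
Proof.
move=> /cliqueP clB S0 sep sol; have [Gs G0 cU PU JU] := sol.
have inU := subsetP (subsetUl A B).
have ne (X : {set 'I_d}) : A :&: B \subset X -> X != set0.
  by move=> SX; apply: contraNneq S0 => X0; rewrite -subset0 -X0.
have inv (X : {set 'I_d}) : A :&: B \subset X -> X \subset A :|: B ->
    exists J, local_inverse (CM Gamma) (cone X) J.
  by move=> SX XU; apply: cone_inverse_exists; rewrite ?ne //; apply: cnd_on_sub cU.
have [K hK] := inv _ (subset_trans (subsetIl A B) (subsetUl A B)) (subxx _).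
have [JA hA] := inv _ (subsetIl A B) (subsetUl A B).
have [JB hB] := inv _ (subsetIr A B) (subsetUr A B).
have [JS hS] := inv _ (subxx _) (subset_trans (subsetIl A B) (subsetUl A B)).
have dec : decoupled (CM Gamma) (cone A) (cone B) JS.
  apply: (@inverse_zero_decoupled _ _ _ _ _ K); first exact: CM_sym.
  - by rewrite -coneU.
  - by rewrite -coneI.
  apply/matrixP => i j; rewrite mul_projE proj_mulE [RHS]mxE.
  case: ifP => // /cone_setD[j' jBA ->]; case: ifP => // /cone_setD[i' iAB ->].
  have [[iA iB] [jB jA]] := (setDP iAB, setDP jBA).
  apply: (JU K hK); rewrite ?inE ?iA ?jB ?orbT //; last exact: sep.
  by apply: contraNneq iB => ->.
have hU := glue_inverse Gs hA hB hS dec.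
split; last by exists JA, JB, JS.
split=> //; first exact: cnd_on_sub (subsetUl A B) cU.
  by move=> i j iA jA; apply: PU; apply: inU.
move=> J hJ i j iA jA ij nij; rewrite (local_inverse_unique hJ hA).
have := JU _ hU i j (inU i iA) (inU j jA) ij nij.
have nB : ~~ ((i \in B) && (j \in B)).
  by apply: contra nij => /andP[iB jB]; apply: clB.
rewrite mxE [X in X + _]mxE [X in _ + X]mxE.
rewrite (local_inverse_lshift_out hB nB) (local_inverse_lshift_out hS).
  by rewrite addr0 subr0.
by apply: contra nB; rewrite !inE => /andP[/andP[_ ->] /andP[_ ->]].
Qed.

(** A solution on [A] is glued with the specified clique [B]; the inverse
    [JA + JB - JS] has the zeros of [JA] away from [B], and non-edges are never
    within [B]. *)
Lemma solves_on_glue A B Gamma : irreflexive e -> clique e B ->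
  A :&: B != set0 -> separated e A B -> symmetric e -> solves_on Gamma A ->
  exists2 Gamma', solves_on Gamma' (A :|: B) & agree_on A Gamma Gamma'.
Proof.
move=> e_irr clB S0 sep e_sym sol; have [Gs G0 cA PA ZA] := sol.
pose Gamma1 : 'M[R]_d := \matrix_(i, j)
  if (i \in A) && (j \in A) then Gamma i j else default_completion i j.
have G1s : Gamma1^T = Gamma1.
  apply/matrixP => i j; rewrite !mxE andbC.
  case: ifP => _; first by rewrite -[in LHS]Gs mxE.
  by have /matrixP/(_ i j) := default_sym; rewrite !mxE.
have G10 i : Gamma1 i i = 0.
  by rewrite mxE G0 default_diag if_same.
have agA : agree_on A Gamma Gamma1 by move=> i j iA jA; rewrite mxE iA jA.
have agS : agree_on (A :&: B) default_completion Gamma.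
  apply: solves_on_clique sol _ (subsetIl A B).
  by apply: clique_sub clB; apply: subsetIr.
have agB : agree_on B default_completion Gamma1.
  move=> i j iB jB; rewrite [RHS]mxE; case: ifP => // /andP[iA jA].
  by apply: agS; rewrite inE ?iA ?jA.
have c1A : cnd_on Gamma1 A by apply: agree_on_cnd cA.
have c1B : cnd_on Gamma1 B by apply: agree_on_cnd agB (clique_cnd_on clB).
have c1S : cnd_on Gamma1 (A :&: B) by apply: cnd_on_sub c1A; apply: subsetIl.
have [JS hS1] := cone_inverse_exists G1s S0 c1S.
have [G2 [G2s G20 ag2A ag2B dec]] := glue_exists G1s G10 hS1.
have ag2 : agree_on A Gamma G2.
  by move=> i j iA jA; rewrite agA // ag2A.
have c2A := agree_on_cnd ag2A c1A; have c2B := agree_on_cnd ag2B c1B.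
have hS : local_inverse (CM G2) (cone (A :&: B)) JS.
  by apply: agree_on_local_inverse hS1; apply: agree_on_sub ag2A; apply: subsetIl.
have A0 : A != set0 by apply: contraNneq S0 => ->; rewrite set0I.
have B0 : B != set0 by apply: contraNneq S0 => ->; rewrite setI0.
have [JA hA] := cone_inverse_exists G2s A0 c2A.
have [JB hB] := cone_inverse_exists G2s B0 c2B.
have hU := glue_inverse G2s hA hB hS dec.
have [_ _ _ P2A Z2A] := solves_on_ext G2s G20 ag2 sol.
exists G2 => //; split=> //; first exact: glue_cnd c2A c2B hS dec.
- move=> i j iU jU eij.
  have ij : i != j by apply: contraTneq eij => ->; rewrite e_irr.
  have [/andP[iA jA]|nA] := boolP ((i \in A) && (j \in A)); first exact: P2A.
  have [/andP[iB jB]|nB] := boolP ((i \in B) && (j \in B)).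
    by rewrite default_edge // agB // ag2B.
  have nsep x y : x \in A -> y \in B -> ~~ ((x \in A) && (y \in A)) ->
      ~~ ((x \in B) && (y \in B)) -> ~~ e x y.
    by move=> xA yB nxA nxB; apply: sep; rewrite inE ?xA ?yB /= ?andbT;
      [move: nxB; rewrite yB andbT | move: nxA; rewrite xA].
  move: iU jU; rewrite !inE => /orP[iA|iB] /orP[jA|jB].
  - by rewrite iA jA in nA.
  - by move: (nsep i j iA jB nA nB); rewrite eij.
  - rewrite andbC in nA; rewrite andbC in nB.
    by move: (nsep j i jA iB nA nB); rewrite e_sym eij.
  - by rewrite iB jB in nB.
move=> J hJ i j iU jU ij nij; rewrite (local_inverse_unique hJ hU).
have nB : ~~ ((i \in B) && (j \in B)).
  by apply: contra nij => /andP[iB jB]; move/cliqueP: clB; apply.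
rewrite mxE [X in X + _]mxE [X in _ + X]mxE.
rewrite (local_inverse_lshift_out hB nB) (local_inverse_lshift_out hS) ?addr0 ?subr0.
  have [/andP[iA jA]|nA] := boolP ((i \in A) && (j \in A)); first exact: Z2A.
  exact: local_inverse_lshift_out hA nA.
by apply: contra nB; rewrite !inE => /andP[/andP[_ ->] /andP[_ ->]].
Qed.

Lemma agree_on_setU A B Gamma Gamma' : clique e B -> A :&: B != set0 ->
  separated e A B -> solves_on Gamma (A :|: B) -> solves_on Gamma' (A :|: B) ->
  agree_on A Gamma Gamma' -> agree_on (A :|: B) Gamma Gamma'.
Proof.
move=> clB S0 sep sol sol' agA.
have agB : agree_on B Gamma Gamma'.
  move=> i j iB jB.
  rewrite -(solves_on_clique sol clB (subsetUr A B)) //.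
  exact: (solves_on_clique sol' clB (subsetUr A B)).
have [_ [_ [_ [JS [_ _ hS dec _]]]]] := solves_on_split clB S0 sep sol.
have [_ [_ [_ [JS' [_ _ hS' dec' _]]]]] := solves_on_split clB S0 sep sol'.
have agS : agree_on (A :&: B) Gamma Gamma' by apply: agree_on_sub agA; apply: subsetIl.
have eJ := local_inverse_unique hS' (agree_on_local_inverse agS hS).
rewrite eJ in dec'; have agAB := decoupled_unique agA agB hS dec dec'.
have [Gs _ _ _ _] := sol; have [Gs' _ _ _ _] := sol'.
move=> i j; rewrite !inE => iU jU.
have [iA|iA] := boolP (i \in A); have [jA|jA] := boolP (j \in A).
- exact: agA.
- rewrite (negbTE jA) /= in jU; have [iB|iB] := boolP (i \in B); first exact: agB.
  by apply: agAB; rewrite inE ?iA ?iB ?jA ?jU.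
- rewrite (negbTE iA) /= in iU; have [jB|jB] := boolP (j \in B); first exact: agB.
  by rewrite -Gs -Gs' !mxE; apply: agAB; rewrite inE ?iA ?iU ?jA ?jB.
- by rewrite (negbTE iA) (negbTE jA) /= in iU jU; apply: agB.
Qed.

Lemma solves_on_unique_exists W : symmetric e -> irreflexive e -> chordal e ->
  W != set0 -> connected_on e W ->
  exists Gamma, solves_on Gamma W /\
    forall Gamma', solves_on Gamma' W -> agree_on W Gamma Gamma'.
Proof.
move=> e_sym e_irr chG; move: W.
apply: (@chordal_connected_ind d e e_sym e_irr _ chG) => [C C0 clC|A B clB S0 sep].
  exists default_completion; split; last first.
    by move=> Gamma' sol; apply: solves_on_clique sol clC (subxx C).
  split; [exact: default_sym|exact: default_diag|exact: clique_cnd_on| |].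
    move=> i j iC jC eij; apply: default_edge => //.
    by apply: contraTneq eij => ->; rewrite e_irr.
  by move=> J _ i j iC jC ij; move/cliqueP: clC => ->.
move=> [Gamma [sol uniq]].
have [Gamma' sol' ag] := solves_on_glue e_irr clB S0 sep e_sym sol.
exists Gamma'; split=> // Gamma2 sol2.
apply: (agree_on_setU clB S0 sep sol' sol2).
have [sol2A _] := solves_on_split clB S0 sep sol2.
by move=> i j iA jA; rewrite -ag // (uniq _ sol2A).
Qed.

Lemma solves_completionP Gamma : (0 < d)%N ->
  solves_completion e P Gamma <-> solves_on Gamma setT.
Proof.
move=> d0; have T0 : [set: 'I_d] != set0 by apply/set0Pn; exists (Ordinal d0).
split=> [[scnd PG ZG]|sol].
  have [Gs G0 _] := scnd; split=> //; first exact/cnd_on_setT.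
    by move=> i j _ _; apply: PG.
  move=> J hJ i j _ _ ij nij; have := ZG i j ij nij.
  by rewrite (theta_setT hJ) !mxE.
have [J hJ] := solves_on_inverse T0 sol; have [Gs G0 cT PT ZT] := sol.
split; first exact/cnd_on_setT.
  by move=> i j; apply: PT.
by move=> i j ij nij; rewrite (theta_setT hJ) !mxE; apply: (ZT J hJ).
Qed.

Lemma embed_theta_clique C Gamma W J : solves_on Gamma W -> clique e C ->
  C \subset W -> local_inverse (CM Gamma) (cone C) J ->
  embed (theta (principal_sub P C)) = ulsubmx J.
Proof.
move=> sol clC CW hJ.
rewrite (principal_sub_inclusion (solves_on_clique sol clC CW)).
exact: embed_theta hJ.
Qed.

Lemma sum_count_mem (T : finType) (V : nmodType) (F : T -> V) (s : seq T) :
  \sum_(x in [set y in s]) F x *+ count_mem x s = \sum_(x <- s) F x.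
Proof.
rewrite -[RHS]big_undup_iterop_count [RHS]big_uniq ?undup_uniq //=.
by apply: eq_big => [x|x _]; rewrite ?inE ?mem_undup.
Qed.

Lemma clique_ThetaE cs : perfect_sequence e cs -> (0 < size cs)%N ->
  clique_Theta e P cs =
  embed (theta (principal_sub P (nth set0 cs 0))) +
  \sum_(1 <= j < size cs) (embed (theta (principal_sub P (nth set0 cs j))) -
                           embed (theta (principal_sub P (separator cs j)))).
Proof.
move=> [pcs _] cs0; rewrite /clique_Theta sum_count_mem /separators big_map.
rewrite sumrB addrA /index_iota subn1; congr (_ - _).
rewrite -big_enum -(perm_big _ pcs) (big_nth set0) /=.
by rewrite big_ltn // /index_iota subn1.
Qed.

(** Splitting off the cliques from the last to the first, with the terms of the
    removed cliques and separators accumulated in the sum. *)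
Lemma theta_perfect cs Gamma : symmetric e -> irreflexive e ->
  connected_graph e -> perfect_sequence e cs ->
  solves_completion e P Gamma -> theta Gamma = clique_Theta e P cs.
Proof.
move=> e_sym e_irr e_conn perf; have d0 : (0 < d)%N by case: e_conn.
move=> /(solves_completionP _ d0) sol.
have cs0 := size_perfect_gt0 e_conn perf.
have T0 : [set: 'I_d] != set0 by apply/set0Pn; exists (Ordinal d0).
have Csol k : agree_on (nth set0 cs k) default_completion Gamma.
  by apply: solves_on_clique sol (perfect_clique perf k) (subsetT _).
have down k : (0 < k <= size cs)%N -> solves_on Gamma (prefix_union cs k) /\
    exists2 J, local_inverse (CM Gamma) (cone (prefix_union cs k)) J &
    theta Gamma = ulsubmx J + \sum_(k <= j < size cs)
      (embed (theta (principal_sub P (nth set0 cs j))) -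
       embed (theta (principal_sub P (separator cs j)))).
  move=> /andP[k0 kc]; have [n] := ubnP (size cs - k).
  elim: n k k0 kc => // n IH k k0 kc; rewrite ltnS => kn.
  move: kc; rewrite leq_eqVlt => /orP[/eqP->|kc].
    rewrite (prefix_union_size perf); split=> //.
    have [J hJ] := solves_on_inverse T0 sol; exists J => //.
    by rewrite big_geq // addr0 (theta_setT hJ).
  have [|||solU [J hJ thE]] := IH k.+1; rewrite //; first by lia.
  have [|cov con] := perfect_prefix e_sym e_conn perf (_ : 0 < k.+1 <= size cs)%N.
    by [].
  have [|sep S0 _ _] := perfect_step e_sym e_conn perf _ cov con.
    by rewrite k0.
  have clC := perfect_clique perf k.
  rewrite prefix_unionS in solU hJ.
  have [solA [JA [JB [JS [hA hB hS _ hU]]]]] := solves_on_split clC S0 sep solU.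
  split=> //; exists JA => //.
  rewrite thE (local_inverse_unique hJ hU) [in RHS]big_ltn // addrA.
  congr (_ + _).
  have clS : clique e (separator cs k).
    by apply: clique_sub clC; apply: subsetIl.
  have := hS; rewrite -separatorE => hS'.
  rewrite (embed_theta_clique sol clS (subsetT _) hS').
  rewrite (embed_theta_clique sol clC (subsetT _) hB).
  by apply/matrixP => i j; rewrite !mxE addrA.
have [_ [J hJ ->]] := down 1 cs0; rewrite clique_ThetaE //; congr (_ + _).
have U1 : prefix_union cs 1 = nth set0 cs 0.
  by rewrite /prefix_union big_ord_recl big_ord0 setU0.
rewrite U1 in hJ; apply/esym.
exact: embed_theta_clique sol (perfect_clique perf 0) (subsetT _) hJ.
Qed.

End Completions.

Theorem theorem4p7 (R : realType) (d : nat) (e : rel 'I_d)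
    (P : 'M[option R]_d) :
  symmetric e -> irreflexive e ->
  connected_graph e -> chordal e ->
  partial_variogram e P ->
  exists Gamma : 'M[R]_d,
    [/\ solves_completion e P Gamma,
        forall Gamma' : 'M[R]_d, solves_completion e P Gamma' -> Gamma' = Gamma &
        forall cs : seq {set 'I_d}, perfect_sequence e cs ->
          theta Gamma = clique_Theta e P cs].
Proof.
move=> e_sym e_irr e_conn chG pv; have d0 : (0 < d)%N by case: e_conn.
have T0 : [set: 'I_d] != set0 by apply/set0Pn; exists (Ordinal d0).
have [Gamma [sol uniq]] :=
  solves_on_unique_exists pv e_sym e_irr chG T0 (connected_graph_on e_conn).
have solG : solves_completion e P Gamma by apply/solves_completionP.
exists Gamma; split=> // [Gamma' sol'|cs perf].
  by apply/matrixP => i j; apply/esym/uniq => //; apply/solves_completionP.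
exact: theta_perfect.
Qed.
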